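(* Let $\Omega\subset\mathbb{R}^2$ be a bounded open set with $C^1$ boundary, let $S$ be a subset of $\Omega$ with $\mathcal{H}^1(S)<+\infty$, and let $u\in SBV^2(\Omega,S)$. If $|\partial\mathcal{F}|_b(u,S)<+\infty$, then there exists $f\in L^2(\Omega)$ such that $$(\nabla u\,|\,\nabla\varphi)=(f\,|\,\varphi)\qquad\text{for all }\varphi\in SBV^2_0(\Omega,S).$$ Moreover, $2\|f\|\le|\partial\mathcal{F}|_b(u,S)$. If, in addition, $|\partial\mathcal{F}|(u,S)<+\infty$, then we have also $$(\nabla u\,|\,\nabla\varphi)=(f\,|\,\varphi)\qquad\text{for all }\varphi\in SBV^2(\Omega,S).$$
   Context: $SBV(\Omega)$ is the space of special functions of bounded variation on $\Omega$; for $v\in SBV(\Omega)$, $\nabla v$ is the approximate gradient and $S(v)$ is the jump set. $\mathcal{H}^1$ is the one-dimensional Hausdorff measure, $\|\cdot\|$ is the $L^2$ norm on $\Omega$, and $(\cdot|\cdot)$ is the scalar product in $L^2(\Omega)$ or $L^2(\Omega;\mathbb{R}^2)$. $A\,\tilde\subset\,B$ means inclusion up to an $\mathcal{H}^1$-negligible set. For $S\subset\Omega$ with $\mathcal{H}^1(S)<+\infty$: $SBV^2(\Omega,S)$ is the set of $u\in SBV(\Omega)\cap L^2(\Omega)$ with $\nabla u\in L^2(\Omega;\mathbb{R}^2)$ and $S(u)\,\tilde\subset\,S$; $SBV^2_0(\Omega,S)$ is the set of $v\in SBV^2(\Omega,S)$ whose trace vanishes $\mathcal{H}^1$-a.e.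 on $\partial\Omega$. The Mumford–Shah functional is $\mathcal{F}(u,S):=\|\nabla u\|^2+\mathcal{H}^1(S)$, for $u\in SBV(\Omega)$ and $S(u)\,\tilde\subset\,S$ (with value $+\infty$ if either term is infinite). The unilateral slope is $$|\partial\mathcal{F}|(u,S):=\limsup_{v\to u}\frac{(\mathcal{F}(u,S)-\mathcal{F}(v,S\cup S(v)))^+}{\|v-u\|},$$ where $v\in SBV(\Omega)$, $v\to u$ in $L^2(\Omega)$ ($v\neq u$), and $(\cdot)^+$ is the positive part. The slope with fixed boundary conditions is $$|\partial\mathcal{F}|_b(u,S):=\limsup_{v\to u,\ v=u\text{ on }\partial\Omega}\frac{(\mathcal{F}(u,S)-\mathcal{F}(v,S\cup S(v)))^+}{\|v-u\|},$$ where $v=u$ on $\partial\Omega$ means that the traces of $v$ and $u$ agree $\mathcal{H}^1$-a.e. on $\partial\Omega$. *)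

(* Defs.v *)
From HB Require Import structures.
From mathcomp Require Import all_boot all_order all_algebra.
From mathcomp Require Import all_classical all_reals all_analysis.

Set Implicit Arguments.
Unset Strict Implicit.
Unset Printing Implicit Defensive.

Import Order.TTheory GRing.Theory Num.Theory.
Import numFieldNormedType.Exports.

Local Open Scope classical_set_scope.
Local Open Scope ring_scope.

(* Functions on an open set Omega of the plane are represented by total
   functions on R * R; no definition below depends on their values outside
   Omega.  "Measurable" means Borel measurable (every Lebesgue class has a Borel
   representative). *)

Section plane.
Variable R : realType.
Local Notation plane := (R * R)%type.

(* The type of the plane that carries the Borel sigma-algebra (generated by
   half-open rectangles) on which lebesgue_measure is a measure. *)
Local Notation mplane := (measurableTypeR R * measurableTypeR R)%type.
Local Notation mu := (@lebesgue_measure R \x @lebesgue_measure R)%E.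

(* The library norm of R * R is the sup norm; distances that matter metrically
   (balls, diameters, rotations) are Euclidean. *)
Definition dot (x y : plane) : R := x.1 * y.1 + x.2 * y.2.
Definition enorm (x : plane) : R := Num.sqrt (dot x x).
Definition eball (x : plane) (r : R) : set plane := [set y | enorm (y - x) < r].

Definition ediam (A : set plane) : \bar R :=
  maxe 0%E (ereal_sup [set (enorm (p.1 - p.2))%:E | p in A `*` A]).

(* For dimension 1 the normalisation constant omega_1 / 2 is 1. *)
Definition hausdorff1_pre (delta : R) (A : set plane) : \bar R :=
  ereal_inf [set (\sum_(0 <= k <oo) ediam (C k))%E | C in
    [set C : nat -> set plane | A `<=` \bigcup_k C k
                               /\ forall k, (ediam (C k) <= delta%:E)%E]].

Definition hausdorff1 (A : set plane) : \bar R :=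
  ereal_sup [set hausdorff1_pre delta A | delta in [set delta | 0 < delta]].

Definition h1_subset (A B : set plane) : Prop := hausdorff1 (A `\` B) = 0%E.

Definition boundary (Omega : set plane) : set plane :=
  closure Omega `\` interior Omega.

Definition C1 (V : normedModType R) (f : V -> R) : Prop :=
  (forall x, differentiable f x) /\ (forall v, continuous (fun x => 'D_v f x)).

(* Near each boundary point Omega is, in the positive orthonormal frame (t, n),
   the strict subgraph of a C^1 function. *)
Definition C1_boundary (Omega : set plane) : Prop :=
  forall x, boundary Omega x ->
  exists (t : plane) (r : R) (g : R -> R),
    let n := (- t.2, t.1) in
    [/\ enorm t = 1, 0 < r, C1 g &
        forall y, eball x r y ->
          (Omega y <-> dot (y - x) n < g (dot (y - x) t))].

Section on_domain.
Variable Omega : set plane.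

Definition L2norm (f : plane -> R) : \bar R :=
  ('N[mu]_2%:E[EFin \o (f \_ Omega)])%E.

Definition inL1 (f : plane -> R) : Prop := f \_ Omega \in Lfun mu 1%E.
Definition inL2 (f : plane -> R) : Prop := f \_ Omega \in Lfun mu 2%:E.

Definition L2dot (f g : plane -> R) : R := \int[mu]_(x in Omega) (f x * g x).
Definition L2dotv (f g : plane -> plane) : R :=
  \int[mu]_(x in Omega) dot (f x) (g x).

(* For x in Omega this says that z is the approximate limit of u at x; for x in
   the boundary of Omega it says that z is the value at x of the trace of u.
   Averages over the balls are replaced by the factor rho^-2, which only changes
   them by a constant. *)
Definition approx_lim (u : plane -> R) (x : plane) (z : R) : Prop :=
  (((rho ^- 2)%:E *
    \int[mu]_(y in Omega `&` eball x rho) `|u y - z|%:E)%E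
     @[rho --> 0^'+] --> 0%E).

(* S(u), as the approximate discontinuity set of u in Omega; for u of bounded
   variation it differs from the set of approximate jump points by an
   H^1-negligible set (Federer-Vol'pert), and only S(u) up to such sets matters. *)
Definition jump_set (u : plane -> R) : set plane :=
  [set x | Omega x /\ ~ exists z, approx_lim u x z].

Definition is_approx_grad (u : plane -> R) (x L : plane) : Prop :=
  exists2 z, approx_lim u x z &
   (((rho ^- 3)%:E *
     \int[mu]_(y in Omega `&` eball x rho) `|u y - z - dot L (y - x)|%:E)%E
      @[rho --> 0^'+] --> 0%E).

Definition approx_grad (u : plane -> R) (x : plane) : plane :=
  xget 0 [set L | is_approx_grad u x L].

(* An element of L^2 is defined almost everywhere, so existence a.e. of the
   approximate gradient is part of the condition; for functions of bounded
   variation it is automatic (Calderon-Zygmund). *)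
Definition approx_grad_inL2 (u : plane -> R) : Prop :=
  [/\ {ae mu, forall x, Omega x -> exists L, is_approx_grad u x L},
      inL2 (fun x => (approx_grad u x).1) &
      inL2 (fun x => (approx_grad u x).2)].

Definition test_function (phi : plane -> R) : Prop :=
  C1 phi /\ exists2 K, compact K /\ K `<=` Omega & forall x, ~ K x -> phi x = 0.

Definition charge_integral (nu : {charge set mplane -> \bar R})
    (f : plane -> R) : R :=
  let: exist P exN := cid (Hahn_decomposition nu) in
  let: exist N nuPN := cid exN in
  \int[jordan_pos nuPN]_x f x - \int[jordan_neg nuPN]_x f x.

Definition distr_derivative (u : plane -> R) (e : plane)
    (nu : {charge set mplane -> \bar R}) : Prop :=
  forall phi, test_function phi ->
    \int[mu]_(x in Omega) (u x * 'D_e phi x) = - charge_integral nu phi.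

Definition singular (nu : {charge set mplane -> \bar R}) : Prop :=
  exists N : set mplane, [/\ measurable N, mu N = 0%E &
    forall A : set mplane, measurable A -> A `&` N = set0 -> nu A = 0%E].

(* The derivative of u in direction e is a finite measure on Omega (extended by
   a finite measure outside Omega, which test functions do not see) whose Cantor
   part, i.e. the restriction to Omega `\` S(u) of its singular part nus, is
   zero.  The set S(u) is not required to be measurable here. *)
Definition no_cantor_derivative (u : plane -> R) (e : plane) : Prop :=
  exists nua nus : {charge set mplane -> \bar R},
    [/\ distr_derivative u e (cadd nua nus), nua `<< mu, singular nus &
        forall A : set mplane, measurable A -> A `<=` Omega `\` jump_set u -> nus A = 0%E].

Definition SBV (u : plane -> R) : Prop :=
  [/\ inL1 u, no_cantor_derivative u (1, 0) & no_cantor_derivative u (0, 1)].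

Definition SBV2 (S : set plane) (u : plane -> R) : Prop :=
  [/\ SBV u, inL2 u, approx_grad_inL2 u & h1_subset (jump_set u) S].

Definition h1_ae_boundary (P : plane -> Prop) : Prop :=
  hausdorff1 (boundary Omega `&` [set x | ~ P x]) = 0%E.

(* Functions of bounded variation have a trace at H^1-almost every point of a
   C^1 boundary, where approx_lim determines it uniquely; hence comparing the
   trace relations pointwise compares the traces. *)
Definition same_trace (u v : plane -> R) : Prop :=
  h1_ae_boundary (fun x => forall z, approx_lim u x z <-> approx_lim v x z).

Definition zero_trace (u : plane -> R) : Prop :=
  h1_ae_boundary (fun x => approx_lim u x 0).

Definition SBV2_0 (S : set plane) (u : plane -> R) : Prop :=
  SBV2 S u /\ zero_trace u.

Definition mumford_shah (u : plane -> R) (S : set plane) : \bar R :=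
  (\int[mu]_(x in Omega) (dot (approx_grad u x) (approx_grad u x))%:E
   + hausdorff1 S)%E.

(* The limsup is taken in [0, +oo], so that it is 0 if there is no competitor
   (which happens only when Omega is empty). *)
Definition slope_among (competitor : (plane -> R) -> Prop)
    (u : plane -> R) (S : set plane) : \bar R :=
  let quotient v :=
    (maxe 0 (mumford_shah u S - mumford_shah v (S `|` jump_set v))
     / L2norm (v \- u)%R)%E in
  let near delta : set (plane -> R) :=
    [set v | [/\ SBV v, competitor v & (0 < L2norm (v \- u)%R < delta%:E)%E]] in
  maxe 0%E (ereal_inf
    [set ereal_sup (quotient @` near delta) | delta in [set delta | 0 < delta]]).

Definition slope (u : plane -> R) (S : set plane) : \bar R :=
  slope_among (fun=> True) u S.

Definition slope_bc (u : plane -> R) (S : set plane) : \bar R :=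
  slope_among (same_trace u) u S.

End on_domain.
End plane.

(* Main.v *)
(* Perturbing u by a small multiple of an admissible phi and expanding the square
   shows that the slope bounds 2 (grad u | grad phi) / ||phi||, since H^1(S) does
   not grow.  Hence phi |-> (grad u | grad phi) is a bounded linear functional for
   the L^2 norm and is represented by some f.  Closedness of SBV^2(Omega, S) under
   sums is avoided: the Cantor part of D(u + c phi) can only live on sets which are
   almost disjoint for different c, so u + c phi is in SBV for all but countably
   many c, and the Riesz representation is obtained by minimisation over such an
   almost-subspace.  When the slope without boundary conditions is finite too, its
   representative agrees with f because both give the same result against products
   of one-dimensional C^1 bumps, whose span is dense in L^2(Omega). *)
From HB Require Import structures.
From mathcomp Require Import all_boot all_order all_algebra.
From mathcomp Require Import all_classical all_reals all_analysis.
From mathcomp Require Import measurable_realfun.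
From mathcomp Require Import ring lra.
Require Import Defs.
Set Implicit Arguments.
Unset Strict Implicit.
Unset Printing Implicit Defensive.
Import Order.TTheory GRing.Theory Num.Theory.
Import numFieldNormedType.Exports.
Local Open Scope classical_set_scope.
Local Open Scope ring_scope.

(** * The Riesz representation in L^2 *)

(** The obstacle is cancellation of jumps. For [u] and [phi] in SBV, the jump set of [u + c phi] may
    miss points where both functions jump, and membership in SBV then requires the singular part of
    the derivative to vanish there. If the approximate limit exists at a point for two different
    values of [c], then both functions have approximate limits at that point, and on sets of such
    points both singular parts vanish; hence the almost disjointness. The price is that only generic
    coefficients are available, so each argument has to survive a small change of coefficient: the
    energy [|phi|^2 - 2 L(phi)] is polynomial in the coefficients, and the slope estimate leaves a
    margin around the chosen step. The constant 2 in the bound on [f] is that of the linear term in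
    the expansion of the squared gradient. The bumps are continuous and vanish on the boundary of
    [Omega], so they are admissible for both slopes, whatever [S] is. *)

Lemma cvg_EFin_fun (R : realType) (I : Type) (F : set_system I) {FF : Filter F}
  (f : I -> R) (l : R) : f x @[x --> F] --> l -> (f x)%:E @[x --> F] --> l%:E.
Proof. by move=> fl; apply: cvg_EFin => //; exact: nearW. Qed.

Section L2_inner_product.
Context d (T : measurableType d) (R : realType) (mu : {measure set T -> \bar R}).
Implicit Types f g h : T -> R.

Definition ip f g : R := \int[mu]_x (f x * g x).

Lemma Lfun2_measurable f : f \in Lfun mu 2%:E -> measurable_fun setT f.
Proof. by move=> /sub_Lfun_mfun; rewrite inE. Qed.

Lemma Lfun2D f g : f \in Lfun mu 2%:E -> g \in Lfun mu 2%:E ->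
  f + g \in Lfun mu 2%:E.
Proof.
by move=> fL gL; have [_] := @Lfun_addr_closed _ _ _ mu 2%:E (lee1n 2); exact.
Qed.

Lemma Lfun2Z c f : f \in Lfun mu 2%:E -> c *: f \in Lfun mu 2%:E.
Proof.
move=> /(@Lfun_scale _ _ _ mu f c 2 (ler1n _ 2)).
rewrite (_ : c \o* f = c *: f)//.
by apply/funext => x; rewrite /= mulrC.
Qed.

Lemma Lfun2B f g : f \in Lfun mu 2%:E -> g \in Lfun mu 2%:E ->
  f - g \in Lfun mu 2%:E.
Proof. by move=> fL gL; rewrite -scaleN1r Lfun2D// Lfun2Z. Qed.

Lemma ip_integrable f g : f \in Lfun mu 2%:E -> g \in Lfun mu 2%:E ->
  mu.-integrable setT (fun x => (f x * g x)%:E).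
Proof. by move=> fL gL; have /Lfun1_integrable := Lfun2_mul_Lfun1 fL gL. Qed.

Lemma EFin_ip f g : f \in Lfun mu 2%:E -> g \in Lfun mu 2%:E ->
  (ip f g)%:E = (\int[mu]_x (f x * g x)%:E)%E.
Proof.
move=> fL gL; rewrite /ip /Rintegral fineK//.
exact/integrable_fin_num/ip_integrable.
Qed.

Lemma Lfun2P f : measurable_fun setT f ->
  (\int[mu]_x (f x * f x)%:E < +oo)%E -> f \in Lfun mu 2%:E.
Proof.
move=> mf foo; rewrite inE; apply/andP; split; rewrite inE//=.
rewrite /finite_norm unlock poweR_lty//=; move: foo.
rewrite (eq_integral (fun x => (`|f x| `^ 2)%:E))// => x _.
by rewrite powR_mulrn// real_normK ?num_real// expr2.
Qed.

Lemma ipC f g : ip f g = ip g f.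
Proof. by apply: eq_Rintegral => x _; rewrite mulrC. Qed.

Lemma ipDl f g h : f \in Lfun mu 2%:E -> g \in Lfun mu 2%:E ->
  h \in Lfun mu 2%:E -> ip (f + g) h = ip f h + ip g h.
Proof.
move=> fL gL hL; rewrite /ip -RintegralD//; try exact: ip_integrable.
by apply: eq_Rintegral => x _; rewrite mulrDl.
Qed.

Lemma ipZl c f h : f \in Lfun mu 2%:E -> h \in Lfun mu 2%:E ->
  ip (c *: f) h = c * ip f h.
Proof.
move=> fL hL; rewrite /ip -RintegralZl//; last exact: ip_integrable.
by apply: eq_Rintegral => x _; rewrite mulrA.
Qed.

Lemma ipBl f g h : f \in Lfun mu 2%:E -> g \in Lfun mu 2%:E ->
  h \in Lfun mu 2%:E -> ip (f - g) h = ip f h - ip g h.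
Proof.
by move=> fL gL hL; rewrite -scaleN1r ipDl ?Lfun2Z// ipZl// mulN1r.
Qed.

Lemma ip_combr a b f g h : f \in Lfun mu 2%:E -> g \in Lfun mu 2%:E ->
  h \in Lfun mu 2%:E -> ip h (a *: f + b *: g) = a * ip h f + b * ip h g.
Proof.
by move=> fL gL hL; rewrite ipC ipDl ?Lfun2Z// !ipZl// (ipC f) (ipC g).
Qed.

Lemma ip_ge0 f : 0 <= ip f f.
Proof. by apply: Rintegral_ge0 => x _; rewrite -expr2 sqr_ge0. Qed.

Lemma ip_quad a b f g : f \in Lfun mu 2%:E -> g \in Lfun mu 2%:E ->
  ip (a *: f + b *: g) (a *: f + b *: g) =
  a ^+ 2 * ip f f + 2 * a * b * ip f g + b ^+ 2 * ip g g.
Proof.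
move=> fL gL; have sL := Lfun2D (Lfun2Z a fL) (Lfun2Z b gL).
rewrite ipDl ?Lfun2Z// !ipZl// !(ipC _ (_ + _)) !ipDl ?Lfun2Z// !ipZl//.
by rewrite (ipC g f); ring.
Qed.

Lemma ip_sub f g : f \in Lfun mu 2%:E -> g \in Lfun mu 2%:E ->
  ip (f - g) (f - g) = ip f f - 2 * ip f g + ip g g.
Proof.
by move=> fL gL; rewrite -scaleN1r -[f in f + _]scale1r ip_quad//; ring.
Qed.

Lemma cauchy_schwarz f g : f \in Lfun mu 2%:E -> g \in Lfun mu 2%:E ->
  ip f g ^+ 2 <= ip f f * ip g g.
Proof.
move=> fL gL; have [g0|g0] := eqVneq (ip g g) 0.
  rewrite g0 mulr0; have [->|fg0] := eqVneq (ip f g) 0; first by rewrite expr0n.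
  (* When [ip g g = 0] the quadratic form is affine in the coefficient of [g]; this coefficient
     makes its value -1. *)
  have := ip_ge0 (1 *: f + (- (1 + ip f f) / (2 * ip f g)) *: g).
  rewrite ip_quad// g0 mulr0 addr0 expr1n mul1r mulr1.
  rewrite (_ : 2 * _ * ip f g = - (1 + ip f f)); last by field.
  by rewrite opprD addrCA subrr addr0 oppr_ge0 ler10.
have gp : 0 < ip g g by rewrite lt_def g0 ip_ge0.
have := ip_ge0 (ip g g *: f + (- ip f g) *: g); rewrite ip_quad//.
have -> : ip g g ^+ 2 * ip f f + 2 * ip g g * - ip f g * ip f g +
   (- ip f g) ^+ 2 * ip g g = ip g g * (ip f f * ip g g - ip f g ^+ 2) by ring.
by rewrite pmulr_rge0// subr_ge0.
Qed.

Lemma Lnorm2E f : f \in Lfun mu 2%:E ->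
  'N[mu]_2%:E[EFin \o f]%E = (Num.sqrt (ip f f))%:E.
Proof.
move=> fL; rewrite unlock /=.
rewrite (_ : (\int[mu]_x _)%E = (ip f f)%:E).
  by rewrite poweR_EFin powR12_sqrt// ip_ge0.
rewrite EFin_ip//; apply: eq_integral => x _.
by rewrite powR_mulrn// real_normK ?num_real// expr2.
Qed.

(** With [D n] the increments, the functions [2 ^+ n * D n ^+ 2] have integrals at most [4 ^- n], so
    their sum is finite almost everywhere. There [|D n| <= 2 ^- n + 2 ^+ n * D n ^+ 2] makes the
    increments absolutely summable. *)
Lemma L2_fast_cauchy_ae_cvg (F : nat -> T -> R) :
  (forall n, F n \in Lfun mu 2%:E) ->
  (forall n, ip (F n.+1 - F n) (F n.+1 - F n) <= (8 ^- n)%R) ->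
  {ae mu, forall x, cvgn (F ^~ x)}.
Proof.
move=> FL Fc.
pose D n : T -> R := F n.+1 - F n.
pose v n x : R := 2 ^+ n * (D n x * D n x).
have DL n : D n \in Lfun mu 2%:E by exact: Lfun2B.
have mv n : measurable_fun setT (v n).
  apply: measurable_funM => //; apply: measurable_funM; exact: Lfun2_measurable.
have v0 n x : 0 <= v n x by rewrite mulr_ge0 ?exprn_ge0// -expr2 sqr_ge0.
have mh : measurable_fun setT (fun x => (\sum_(0 <= n <oo) (v n x)%:E)%E).
  apply: ge0_emeasurable_sum => //.
  - by move=> *; rewrite lee_fin.
  - by move=> *; exact/measurable_EFinP.
have ih : mu.-integrable setT (fun x => (\sum_(0 <= n <oo) (v n x)%:E)%E).
  apply/integrableP; split => //.
  under eq_integral => x _.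
    rewrite gee0_abs; last by apply: nneseries_ge0 => n _ _; rewrite lee_fin.
    over.
  rewrite integral_nneseries//; last 2 first.
  - by move=> n; exact/measurable_EFinP.
  - by move=> n x _; rewrite lee_fin.
  apply: (@le_lt_trans _ _ (\sum_(0 <= n <oo) (geometric 1 (4^-1 : R) n)%:E)%E).
    apply: lee_nneseries => [n _|n _] /=.
      by move=> _; apply: integral_ge0 => x _; rewrite lee_fin.
    rewrite /v; under eq_integral do rewrite EFinM.
    rewrite ge0_integralZl_EFin//; last first.
    - by apply/measurable_EFinP/measurable_funM; exact: Lfun2_measurable.
    - by move=> x _; rewrite lee_fin -expr2 sqr_ge0.
    rewrite -EFin_ip// -EFinM lee_fin mul1r.
    have -> : (4^-1 : R) ^+ n = 2 ^+ n * 8 ^- n.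
      by rewrite -[8 ^- n]exprVn -exprMn; congr (_ ^+ _); lra.
    by rewrite ler_pM2l ?exprn_gt0//; exact: Fc.
  have /cvg_ex[l gl] : cvgn (series (geometric 1 (4^-1 : R))).
    by apply: is_cvg_geometric_series; rewrite ger0_norm; lra.
  suff -> : (\sum_(0 <= n <oo) (geometric 1 (4^-1 : R) n)%:E = l%:E)%E.
    by rewrite ltry.
  apply/cvg_lim => //.
  have -> : (fun n => (\sum_(0 <= i < n) (geometric 1 (4^-1 : R) i)%:E)%E) =
            EFin \o series (geometric 1 (4^-1 : R)).
    by apply/funext => n /=; rewrite sumEFin.
  exact: cvg_EFin_fun.
apply: filterS (integrable_ae measurableT ih) => x /(_ I) hfin.
have cv : cvgn (series (fun n => v n x)).
  apply: nnseries_is_cvg => //.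
  by rewrite -ge0_fin_numE//; apply: nneseries_ge0 => n _ _; rewrite lee_fin.
have cg : cvgn (series (geometric 1 (2^-1 : R))).
  by apply: is_cvg_geometric_series; rewrite ger0_norm; lra.
have cw : cvgn (series (fun n => geometric 1 (2^-1 : R) n + v n x)).
  have := is_cvgD cg cv; rewrite -seriesD.
  exact.
have cD : cvgn (series (fun n => D n x)).
  apply: normed_cvg; apply: series_le_cvg cw => [n|n|n] /=.
  - exact: normr_ge0.
  - by rewrite addr_ge0// ?v0// mul1r exprn_ge0.
  rewrite mul1r /v exprVn; set a := (2 ^+ n : R).
  have a0 : 0 < a by rewrite exprn_gt0.
  have -> : D n x * D n x = `|D n x| ^+ 2.
    by rewrite real_normK ?num_real// expr2.
  rewrite -(ler_pM2l a0) mulrDr divff ?gt_eqF//.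
  rewrite [X in _ <= _ + X](_ : _ = (a * `|D n x|) ^+ 2); last by rewrite exprMn; ring.
  have := sqr_ge0 (a * `|D n x| - 1); have := sqr_ge0 (a * `|D n x|).
  set y := a * `|D n x|; nra.
have -> : F ^~ x = (fun n => F 0%N x + series (fun n => D n x) n).
  by apply/funext => n; rewrite (eq_sum_telescope (F ^~ x) n).
by apply: is_cvgD => //; exact: is_cvg_cst.
Qed.

(** The limit is defined everywhere as an upper limit, which keeps it measurable. Fatou's lemma
    along the shifted sequence [F (k + n)] then turns the Cauchy rate into the same rate of
    convergence. *)
Lemma L2_complete (F : nat -> T -> R) :
  (forall n, F n \in Lfun mu 2%:E) ->
  (forall n k, (n <= k)%N -> ip (F k - F n) (F k - F n) <= (8 ^- n)%R) ->
  exists2 f, f \in Lfun mu 2%:E &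
    forall n, ip (f - F n) (f - F n) <= (8 ^- n)%R.
Proof.
move=> FL Fc.
have aec := L2_fast_cauchy_ae_cvg FL (fun n => Fc n n.+1 (leqnSn n)).
pose f x := fine (limn_esup (fun n => (F n x)%:E)).
have mf : measurable_fun setT f.
  apply: (measurableT_comp (fine_measurable measurableT)).
  apply: measurable_fun_limn_esup => n.
  exact/measurable_EFinP/Lfun2_measurable.
have aef : {ae mu, forall x, F n x @[n --> \oo] --> f x}.
  apply: filterS aec => x /cvg_ex[l Fl].
  suff -> : f x = l by [].
  by rewrite /f (cvg_limn_einf_sup (cvg_EFin_fun Fl)).2.
have bnd n : (\int[mu]_x ((f - F n) x * (f - F n) x)%:E <= (8 ^- n)%:E)%E.
  pose G k x := ((F (k + n)%N - F n) x * (F (k + n)%N - F n) x)%:E.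
  have mG k : measurable_fun setT (G k).
    by apply/measurable_EFinP/measurable_funM; exact/Lfun2_measurable/Lfun2B.
  have G0 k x : setT x -> (0 <= G k x)%E.
    by move=> _; rewrite lee_fin -expr2 sqr_ge0.
  have := fatou mu measurableT mG G0.
  rewrite (ae_eq_integral (fun x => ((f - F n) x * (f - F n) x)%:E))//; last 3 first.
  - rewrite /limn_einf; apply: measurableT_comp => //.
    apply: measurable_fun_limn_esup => k; exact: measurableT_comp.
  - apply/measurable_EFinP/measurable_funM; apply: measurable_funB => //; exact: Lfun2_measurable.
  - apply: filterS aef => x Fx _.
    have Fx' : (F (k + n)%N - F n) x @[k --> \oo] --> (f - F n) x.
      apply: cvgB; last exact: cvg_cst.
      by rewrite (cvg_shiftn n (F ^~ x)).
    exact: (cvg_limn_einf_sup (cvg_EFin_fun (cvgM Fx' Fx'))).1.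
  move/le_trans; apply.
  rewrite limn_einf_lim; apply: lime_le; first exact: is_cvg_einfs.
  apply: nearW => m; apply: ereal_inf_le; exists (\int[mu]_x G m x)%E.
    by exists m => //=.
  by rewrite -EFin_ip ?Lfun2B// lee_fin Fc// leq_addl.
have fFL n : f - F n \in Lfun mu 2%:E.
  apply: Lfun2P; last by apply: le_lt_trans (bnd n) _; rewrite ltry.
  by apply: measurable_funB => //; exact: Lfun2_measurable.
exists f; first by rewrite -(subrK (F 0%N) f) Lfun2D.
by move=> n; rewrite -lee_fin EFin_ip.
Qed.

Lemma cvg0_sqr_le (x : nat -> R) C : (forall n, x n ^+ 2 <= C * 8 ^- n) ->
  x n @[n --> \oo] --> (0 : R).
Proof.
move=> xC; apply/norm_cvg0P.
have -> : (fun n => `|x n|) = (fun n => Num.sqrt (x n ^+ 2)).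
  by apply/funext => n; rewrite sqrtr_sqr.
rewrite -(@sqrtr0 R).
apply: (@cvg_comp _ _ _ (fun n => x n ^+ 2) Num.sqrt); last exact: sqrt_continuous.
apply: (@squeeze_cvgr _ _ _ _ (cst 0) (geometric C (8^-1))).
- by apply: nearW => n /=; rewrite sqr_ge0 exprVn xC.
- exact: cvg_cst.
- by apply: cvg_geometric; rewrite ger0_norm; lra.
Qed.

(* [V] need not be a subspace: it suffices that it contains combinations
   [a *: phi + c *: psi] with [c] arbitrarily close to any given number, because
   the energy minimised below is continuous in [c]. *)
Lemma riesz_almost_subspace (I : lmodType R) (V : set I) (r : I -> T -> R)
    (L : I -> R) (M : R) :
  V !=set0 -> 0 <= M ->
  (forall (a b : R) phi psi, r (a *: phi + b *: psi) = a *: r phi + b *: r psi) ->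
  (forall phi, V phi -> r phi \in Lfun mu 2%:E) ->
  (forall phi psi (a b e : R), V phi -> V psi -> a != 0 -> 0 < e ->
     exists c, [/\ `|b - c| < e, V (a *: phi + c *: psi) &
       L (a *: phi + c *: psi) = a * L phi + c * L psi]) ->
  (forall phi, V phi -> L phi <= M * Num.sqrt (ip (r phi) (r phi))) ->
  exists f, [/\ f \in Lfun mu 2%:E, forall phi, V phi -> ip f (r phi) = L phi &
    Num.sqrt (ip f f) <= M].
Proof.
move=> [phi0 Vphi0] M0 rlin rL2 Vdense LM.
(* If [f] represents [L], then [Q phi] is the squared distance from [r phi] to [f], minus [ip f f].
   Minimising [Q] therefore approximates the unknown [f]. *)
pose Q phi := ip (r phi) (r phi) - 2 * L phi.
pose m := inf (Q @` V).
have Qlb phi : V phi -> - M ^+ 2 <= Q phi.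
  move=> Vphi; have := LM _ Vphi; rewrite /Q.
  rewrite -[ip (r phi) _ in X in _ -> X]sqr_sqrtr ?ip_ge0//.
  set t := Num.sqrt _; have := sqr_ge0 (t - M); nra.
have Qinf : has_inf (Q @` V).
  split; first by exists (Q phi0), phi0.
  by exists (- M ^+ 2) => _ [phi Vphi <-]; exact: Qlb.
have mQ phi : V phi -> m <= Q phi.
  by move=> Vphi; apply: ge_inf; [exact: Qinf.2|exists phi].
have mcomb phi psi a b : V phi -> V psi -> a != 0 ->
    m <= a ^+ 2 * ip (r phi) (r phi) + 2 * a * b * ip (r phi) (r psi) +
      b ^+ 2 * ip (r psi) (r psi) - 2 * (a * L phi + b * L psi).
  move=> Vphi Vpsi a0; rewrite leNgt; apply/negP => qlt.
  pose q c := a ^+ 2 * ip (r phi) (r phi) + 2 * a * c * ip (r phi) (r psi) +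
      c ^+ 2 * ip (r psi) (r psi) - 2 * (a * L phi + c * L psi).
  have qb : q c @[c --> b] --> q b.
    apply: cvgB.
      apply: cvgD.
        apply: cvgD; first exact: cvg_cst.
        by apply: cvgMl; apply: cvgMr; exact: cvg_id.
      by apply: cvgMl; apply: cvgM; exact: cvg_id.
    apply: cvgMr; apply: cvgD; first exact: cvg_cst.
    by apply: cvgMl; exact: cvg_id.
  have /nbhs_ballP[e /= e0 eq] : \forall c \near b, q c < m by exact: (cvgr_lt _ qb).
  have [c [bc Vc Lc]] := Vdense phi psi a b e Vphi Vpsi a0 e0.
  have := mQ _ Vc; rewrite /Q Lc rlin ip_quad ?rL2//.
  by rewrite leNgt => /negP; apply; exact: eq.
have /choice[p pP] n : exists phi, V phi /\ Q phi < m + 8 ^- n / 4.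
  have e0 : (0 : R) < 8 ^- n / 4 by rewrite divr_gt0// invr_gt0 exprn_gt0.
  by have [_ [phi Vphi <-] ?] := inf_adherent e0 Qinf; exists phi.
have Vp n : V (p n) by case: (pP n).
have pL2 n : r (p n) \in Lfun mu 2%:E by exact: rL2.
have [f fL2 fP] : exists2 f, f \in Lfun mu 2%:E &
    forall n, ip (f - r (p n)) (f - r (p n)) <= 8 ^- n.
  apply: L2_complete => // n k nk; rewrite ip_sub//.
  have half_neq0 : 2^-1 != 0 :> R by rewrite invr_eq0 pnatr_eq0.
  (* Parallelogram identity at the midpoint: the squared distance is at most twice the sum of the
     two excesses over [m]. The slack [8 ^- n / 4] was chosen so that this is at most [8 ^- n]. *)
  have := mcomb _ _ 2^-1 2^-1 (Vp n) (Vp k) half_neq0.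
  have [_] := pP n; have [_] := pP k; rewrite /Q (ipC (r (p k)) (r (p n))).
  have : (8 ^- k : R) <= 8 ^- n.
    by rewrite lef_pV2 ?posrE ?exprn_gt0// ler_weXn2l// ler1n.
  lra.
have cvgp g : g \in Lfun mu 2%:E -> ip g (r (p n)) @[n --> \oo] --> ip g f.
  move=> gL2; apply/subr_cvg0.
  apply: (@cvg0_sqr_le _ (ip g g)) => n.
  rewrite (_ : _ - _ = - ip g (f - r (p n))); last first.
    by rewrite !(ipC g) ipBl//; lra.
  rewrite sqrrN; apply: le_trans (cauchy_schwarz _ _) _ => //.
    exact: Lfun2B.
  by rewrite ler_wpM2l ?ip_ge0.
have fV phi : V phi -> ip f (r phi) = L phi.
  move=> Vphi; have phiL2 := rL2 _ Vphi.
  pose N := ip (r phi) (r phi); have N0 : 0 <= N by exact: ip_ge0.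
  pose D := ip f (r phi) - L phi.
  (* First-order condition: minimality at [p n] perturbed by [t] times [phi], in the limit of large
     [n]. A parabola without constant term that is nonnegative everywhere has zero slope at 0. *)
  have DN t : 0 <= 2 * t * D + t ^+ 2 * N.
    pose s n := 8 ^- n / 4 + 2 * t * (ip (r phi) (r (p n)) - L phi) + t ^+ 2 * N.
    have s0 n : 0 <= s n.
      have := mcomb _ _ 1 t (Vp n) Vphi (oner_neq0 _).
      have [_] := pP n; rewrite /s /Q (ipC (r phi)) -/N; lra.
    have : s n @[n --> \oo] --> 0 / 4 + 2 * t * (ip (r phi) f - L phi) + t ^+ 2 * N.
      apply: cvgD; last exact: cvg_cst.
      apply: cvgD.
        apply: cvgMl.
        have := @cvg_geometric R 1 8^-1; under eq_cvg do rewrite /= mul1r exprVn.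
        by apply; rewrite ger0_norm; lra.
      by apply: cvgMr; apply: cvgB; [exact: cvgp|exact: cvg_cst].
    rewrite mul0r add0r (ipC _ f) => sl; rewrite -(cvg_lim (@Rhausdorff R) sl).
    by apply: limr_ge; [exact: cvgP sl|exact: nearW].
  apply/eqP; rewrite -subr_eq0 -/D; apply/eqP.
  (* The denominator is [N + 1] rather than [N] because [N] may be zero. *)
  have := DN (- D / (N + 1)).
  have -> : 2 * (- D / (N + 1)) * D + (- D / (N + 1)) ^+ 2 * N =
    - (D ^+ 2 * (N + 2) / (N + 1) ^+ 2) by field; lra.
  have N1 : 0 < N + 1 by lra.
  have N2 : 0 < N + 2 by lra.
  rewrite oppr_ge0 pmulr_lle0 ?invr_gt0 ?exprn_gt0// pmulr_lle0// => D20.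
  by apply/eqP; rewrite -sqrf_eq0 eq_le D20 sqr_ge0.
exists f; split => //.
(* On the minimising sequence [ip f (r (p n)) = L (p n) <= M * |r (p n)|]; the limit reads
   [|f|^2 <= M * |f|], although [f] need not come from [V]. *)
have : (M * Num.sqrt (ip f f) - ip f f) >= 0.
  have c1 : ip (r (p n)) (r (p n)) @[n --> \oo] --> ip f f.
    have -> : (fun n => ip (r (p n)) (r (p n))) = (fun n =>
        ip (f - r (p n)) (f - r (p n)) + 2 * ip f (r (p n)) - ip f f).
      by apply/funext => n; rewrite ip_sub//; lra.
    rewrite [X in _ --> X](_ : ip f f = 0 + 2 * ip f f - ip f f); last by lra.
    apply: cvgB; last exact: cvg_cst.
    apply: cvgD; last by apply: cvgMr; exact: cvgp.
    apply: (@squeeze_cvgr _ _ _ _ (cst 0) (geometric 1 (8^-1))).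
    - by apply: nearW => n /=; rewrite ip_ge0 exprVn mul1r fP.
    - exact: cvg_cst.
    - by apply: cvg_geometric; rewrite ger0_norm; lra.
  have c2 : M * Num.sqrt (ip (r (p n)) (r (p n))) - ip f (r (p n)) @[n --> \oo]
      --> M * Num.sqrt (ip f f) - ip f f.
    apply: cvgB; last exact: cvgp.
    apply: cvgMr.
    by apply: (@cvg_comp _ _ _ _ Num.sqrt _ _ _ c1); exact: sqrt_continuous.
  rewrite -(cvg_lim (@Rhausdorff R) c2).
  apply: limr_ge; [exact: cvgP c2|apply: nearW => n].
  by rewrite fV// subr_ge0 LM.
rewrite subr_ge0 -[X in X <= _ -> _]sqr_sqrtr ?ip_ge0// expr2.
have [->//|s0] := eqVneq (Num.sqrt (ip f f)) 0.
by rewrite ler_pM2r// lt_def s0 sqrtr_ge0.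
Qed.

End L2_inner_product.

(** * Integration against charges *)

Section integral_density.
Context d (T : measurableType d) (R : realType).
Variable mu : {sigma_finite_measure set T -> \bar R}.

(** Integrals over measurable sets determine a density almost everywhere, so [f] coincides with the
    Radon-Nikodym derivative, for which a change of variables formula is available. *)
Lemma ge0_integral_density (f psi : T -> \bar R) (m : {finite_measure set T -> \bar R}) :
  (forall x, 0 <= f x)%E -> mu.-integrable setT f ->
  (forall A, measurable A -> m A = \int[mu]_(x in A) f x)%E ->
  (forall x, 0 <= psi x)%E -> measurable_fun setT psi ->
  (\int[m]_x psi x = \int[mu]_x (psi x * f x))%E.
Proof.
move=> f0 fint mE psi0 mpsi.
have mmu : m `<< mu.
  apply/null_content_dominatesP => A mA A0; rewrite mE//.
  apply: null_set_integral => //.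
  by apply: measurable_funTS; exact: measurable_int fint.
rewrite -(Radon_Nikodym_SigmaFinite.change_of_variables mmu)//.
have RNint := Radon_Nikodym_SigmaFinite.f_integrable mmu.
apply: ae_eq_integral => //.
- by apply: emeasurable_funM => //; exact: measurable_int RNint.
- by apply: emeasurable_funM => //; exact: measurable_int fint.
have : ae_eq mu setT (Radon_Nikodym_SigmaFinite.f m mu) f.
  apply: integral_ae_eq => //; first exact: measurable_int fint.
  move=> E _ mEE; rewrite -mE// (Radon_Nikodym_SigmaFinite.f_integral mmu)//.
by apply: filterS => x /(_ I) /= -> _.
Qed.

End integral_density.

Section density_measure.
Context d (T : measurableType d) (R : realType).
Variables (mu : {measure set T -> \bar R}) (f : T -> \bar R).
Hypothesis fint : mu.-integrable setT f.
Hypothesis f0 : (forall x, 0 <= f x)%E.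

Let induced_ge0 A : (0 <= induced_charge fint A)%E.
Proof. exact: integral_ge0. Qed.

Definition density_measure := measure_of_charge _ induced_ge0.

HB.instance Definition _ := Measure.on density_measure.

Let finite_density_measure : fin_num_fun density_measure.
Proof. by move=> A mA; exact: (@fin_num_measure _ _ _ (induced_charge fint)). Qed.

HB.instance Definition _ := @Measure_isFinite.Build _ _ _
  density_measure finite_density_measure.

Lemma density_measureE A : density_measure A = (\int[mu]_(x in A) f x)%E.
Proof. by []. Qed.

End density_measure.

Section charge_difference.
Context d (T : measurableType d) (R : realType).
Implicit Types (psi : T -> R).

(** Moving the subtracted terms across, [p + n'] and [p' + n] are the same measure. Finiteness of
    the four measures and boundedness of [psi] allow the integrals to be subtracted back. *)
Lemma eq_integral_measure_diff (p n p' n' : {measure set T -> \bar R}) psi :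
  (p setT < +oo)%E -> (n setT < +oo)%E -> (p' setT < +oo)%E ->
  (n' setT < +oo)%E ->
  measurable_fun setT psi -> (exists M, forall x, `|psi x| <= M) ->
  (forall A, measurable A -> p A - n A = p' A - n' A)%E ->
  \int[p]_x psi x - \int[n]_x psi x = \int[p']_x psi x - \int[n']_x psi x.
Proof.
move=> pT nT p'T n'T mpsi [M psiM] pn.
have psiint (m : {measure set T -> \bar R}) : (m setT < +oo)%E ->
    m.-integrable setT (EFin \o psi).
  move=> mT; apply: measurable_bounded_integrable => //.
  by exists M; split; rewrite ?num_real// => x Mx y _; rewrite /= (le_trans (psiM y))// ltW.
have addE (m1 m2 : {measure set T -> \bar R}) m1T m2T :=
    @integral_measure_add _ _ _ m1 m2 setT measurableT (EFin \o psi)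
      (psiint m1 m1T) (psiint m2 m2T).
have : (\int[p]_x (psi x)%:E + \int[n']_x (psi x)%:E =
        \int[p']_x (psi x)%:E + \int[n]_x (psi x)%:E)%E.
  rewrite -addE// -addE//; apply: eq_measure_integral => A mA _.
  rewrite /= /msum !big_ord_recl !big_ord0 /= !adde0; have := pn _ mA.
  have pf (m : {measure set T -> \bar R}) : (m setT < +oo)%E -> m A \is a fin_num.
    move=> mT; rewrite ge0_fin_numE// (le_lt_trans _ mT)// le_measure ?inE//.
  rewrite -(fineK (pf p pT)) -(fineK (pf n nT)) -(fineK (pf p' p'T)).
  rewrite -(fineK (pf n' n'T)).
  by move=> [] ?; rewrite -!EFinD; congr EFin; lra.
have fi (m : {measure set T -> \bar R}) : (m setT < +oo)%E ->
    (\int[m]_x (psi x)%:E)%E = (\int[m]_x psi x)%:E.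
  by move=> mT; rewrite /Rintegral fineK//; apply/integrable_fin_num/psiint.
by rewrite !fi// -!EFinD => -[]; lra.
Qed.

Lemma charge_variation_null (nu : {charge set T -> \bar R}) P N
    (nuPN : hahn_decomposition nu P N) (X : set T) : measurable X ->
  (forall A, measurable A -> A `<=` X -> nu A = 0%E) ->
  charge_variation nuPN X = 0%E.
Proof.
move=> mX nuX; have [[mP _] [mN _] _ _] := nuPN.
rewrite /charge_variation /= jordan_posE cjordan_posE jordan_negE cjordan_negE.
rewrite /crestr0 mem_set// /crestr !nuX ?oppe0 ?adde0//.
all: by [exact: measurableI|exact: subIsetl].
Qed.

(* A finite measure gives mass at least 1/k to at most finitely many members of
   an almost disjoint family. *)
Lemma countable_charge_neq0 (I : choiceType) (nu : {charge set T -> \bar R})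
    (good : I -> set T -> Prop) :
  (forall i A, good i A -> measurable A) ->
  (forall i j A B C, i != j -> good i A -> good j B ->
     measurable C -> C `<=` A `&` B -> nu C = 0%E) ->
  countable [set i | exists A, good i A /\ nu A != 0%E].
Proof.
move=> mgood gdisj.
have [P [N nuPN]] := Hahn_decomposition nu.
pose m : {measure set T -> \bar R} := charge_variation nuPN.
have mT : (m setT < +oo)%E.
  by rewrite ltey_eq fin_num_measure.
pose B k := [set i | exists A, good i A /\ ((k.+1%:R^-1)%:E <= m A)%E].
apply: (@sub_countable _ _ _ (\bigcup_k B k)).
  apply: subset_card_le => i [A [gA nuA]].
  have mA0 : (0 < m A)%E.
    rewrite (lt_le_trans _ (abse_charge_variation nuPN (mgood _ _ gA)))//.
    by rewrite lt_def abse_ge0 andbT abse_eq0.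
  have [k _ kA] : exists2 k, True & ((k.+1%:R^-1)%:E <= m A)%E.
    have mAfin : m A \is a fin_num by rewrite fin_num_measure//; exact: mgood gA.
    have a0 : 0 < fine (m A) by rewrite fine_gt0// mA0 ltey_eq mAfin.
    have [k] := ltr_add_invr a0; rewrite add0r => kA.
    by exists k => //; rewrite -(fineK mAfin) lee_fin ltW.
  by exists k => //; exists A.
apply: bigcup_countable => // k _; apply: finite_set_countable.
apply: contrapT => /infinite_set_fset infB.
have /choice[A AP] i : exists A, B k i -> good i A /\ ((k.+1%:R^-1)%:E <= m A)%E.
  by have [[A ?]|nB] := pselect (B k i); [exists A|exists set0].
have mA i : B k i -> measurable (A i) by move=> /AP[/mgood].
(* Overlaps of distinct members are null for the variation, so the masses of finitely many of them
   add up as if they were disjoint. *)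
have lb s : uniq s -> [set` s] `<=` B k ->
    (((size s)%:R * k.+1%:R^-1)%:E <= m (\big[setU/set0]_(i <- s) A i))%E.
  elim: s => [|i s IH]; first by rewrite mul0r measure_ge0.
  move=> /= /andP[inos us] sB; have Bi : B k i by apply: sB; rewrite /= mem_head.
  have sB' : [set` s] `<=` B k.
    by move=> j js; apply: sB; rewrite /= in_cons js orbT.
  have mU : measurable (\big[setU/set0]_(j <- s) A j).
    by rewrite big_seq; apply: bigsetU_measurable => j js; apply/mA/sB'.
  have mAi := mA _ Bi; rewrite big_cons measureUfinl//; last first.
    by rewrite (le_lt_trans _ mT)// le_measure ?inE.
  rewrite [X in (_ - X)%E](_ : _ = 0%E) ?sube0.
    rewrite -natr1 mulrDl mul1r addrC EFinD leeD//; last exact: IH.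
    by have [] := AP _ Bi.
  rewrite setIC big_distrl /= big_seq.
  have nullI j : j \in s ->
      measurable (A j `&` A i) /\ m (A j `&` A i) = 0%E.
    move=> js; have Bj := sB' _ js.
    have mji : measurable (A j `&` A i) by apply: measurableI; exact: mA.
    split => //; apply: charge_variation_null => // C mC CA.
    have [gj _] := AP _ Bj; have [gi _] := AP _ Bi.
    apply: (gdisj j i (A j) (A i)) => //.
    by apply: contraNneq inos => <-.
  suff [] : measurable (\big[setU/set0]_(j <- s | j \in s) (A j `&` A i)) /\
      m (\big[setU/set0]_(j <- s | j \in s) (A j `&` A i)) = 0%E by [].
  apply: (big_ind (fun X => measurable X /\ m X = 0%E)) => //.
  move=> X Y [mX X0] [mY Y0]; split; first exact: measurableU.
  exact: null_set_setU.
have mTfin : m setT \is a fin_num by rewrite fin_num_measure.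
(* More than [k.+1] times the total mass, hence too many members of mass at least [k.+1%:R^-1]. *)
pose n := (Num.truncn (fine (m setT) * k.+1%:R)).+1.
have [F FB nF] := infB n.
have : ((n%:R * k.+1%:R^-1)%:E <= m setT)%E.
  apply: le_trans (le_trans (lb (finmap.enum_fset F) _ FB) _).
  - by rewrite lee_fin ler_wpM2r// ?invr_ge0// ler_nat.
  - exact: finmap.fset_uniq.
  - apply: le_measure => //; rewrite inE//.
    by rewrite big_seq; apply: bigsetU_measurable => j js; apply/mA/FB.
rewrite -(fineK mTfin) lee_fin ler_pdivrMr// leNgt => /negP; apply.
by rewrite /n; exact: truncnS_gt.
Qed.

End charge_difference.

Section charge_integral.
Variable R : realType.
Local Notation mplane := (measurableTypeR R * measurableTypeR R)%type.
Implicit Types (nu : {charge set mplane -> \bar R}) (psi : mplane -> R).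

Let jordan_lty nu P N (nuPN : hahn_decomposition nu P N) :
  (jordan_pos nuPN setT < +oo)%E /\ (jordan_neg nuPN setT < +oo)%E.
Proof. by split; rewrite ltey_eq fin_num_measure. Qed.

Let jordanE nu P N (nuPN : hahn_decomposition nu P N) A : measurable A ->
  nu A = (jordan_pos nuPN A - jordan_neg nuPN A)%E.
Proof. by move=> mA; rewrite (jordan_decomp nuPN mA) /cadd /= cscaleN1. Qed.

(** Frees [charge_integral] from the Hahn decomposition chosen in its definition: every way of
    writing the charge as a difference of finite measures computes it. *)
Lemma charge_integralE nu psi (p n : {measure set mplane -> \bar R}) :
  (p setT < +oo)%E -> (n setT < +oo)%E ->
  measurable_fun setT psi -> (exists M, forall x, `|psi x| <= M) ->
  (forall A, measurable A -> nu A = p A - n A)%E ->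
  charge_integral nu psi = \int[p]_x psi x - \int[n]_x psi x.
Proof.
move=> pT nT mpsi psiM nuE; rewrite /charge_integral.
case: cid => P exN; case: cid => N nuPN.
have [posT negT] := jordan_lty nuPN.
apply: eq_integral_measure_diff => // A mA.
by rewrite -jordanE// nuE.
Qed.

Let integrable_bounded (m : {measure set mplane -> \bar R}) psi :
  (m setT < +oo)%E ->
  measurable_fun setT psi -> (exists M, forall x, `|psi x| <= M) ->
  m.-integrable setT (EFin \o psi).
Proof.
move=> mT mpsi [M psiM]; apply: measurable_bounded_integrable => //.
by exists M; split; rewrite ?num_real// => x Mx y _; rewrite /= (le_trans (psiM y))// ltW.
Qed.

Let Rintegral_measure_add (m1 m2 : {measure set mplane -> \bar R}) psi :
  (m1 setT < +oo)%E -> (m2 setT < +oo)%E ->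
  measurable_fun setT psi -> (exists M, forall x, `|psi x| <= M) ->
  \int[measure_add m1 m2]_x psi x = \int[m1]_x psi x + \int[m2]_x psi x.
Proof.
move=> m1T m2T mpsi psiM.
rewrite /Rintegral (@integral_measure_add _ _ _ m1 m2 setT measurableT (EFin \o psi)).
- by rewrite fineD//; exact/integrable_fin_num/integrable_bounded.
- exact: integrable_bounded.
- exact: integrable_bounded.
Qed.

(** The sums of the positive and of the negative parts form in general not the Jordan decomposition
    of the sum, but they are a difference of finite measures, which is enough by
    [charge_integralE]. *)
Lemma charge_integralD nu1 nu2 psi :
  measurable_fun setT psi -> (exists M, forall x, `|psi x| <= M) ->
  charge_integral (cadd nu1 nu2) psi =
  charge_integral nu1 psi + charge_integral nu2 psi.
Proof.
move=> mpsi psiM.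
have [P1 [N1 PN1]] := Hahn_decomposition nu1.
have [P2 [N2 PN2]] := Hahn_decomposition nu2.
have [p1 n1] := jordan_lty PN1; have [p2 n2] := jordan_lty PN2.
rewrite (@charge_integralE nu1 psi _ _ p1 n1)//; last by move=> *; exact: jordanE.
rewrite (@charge_integralE nu2 psi _ _ p2 n2)//; last by move=> *; exact: jordanE.
rewrite (@charge_integralE _ psi (measure_add (jordan_pos PN1) (jordan_pos PN2))
  (measure_add (jordan_neg PN1) (jordan_neg PN2)))//.
- by rewrite !Rintegral_measure_add//; lra.
- by rewrite /= /msum !big_ord_recl big_ord0 /= adde0 lte_add_pinfty.
- by rewrite /= /msum !big_ord_recl big_ord0 /= adde0 lte_add_pinfty.
move=> A mA; rewrite /= /msum !big_ord_recl !big_ord0 /= !adde0 /cadd.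
rewrite (jordanE PN1)// (jordanE PN2)//.
have fin (m : {measure set mplane -> \bar R}) : (m setT < +oo)%E -> m A \is a fin_num.
  by move=> mT; rewrite ge0_fin_numE// (le_lt_trans _ mT)// le_measure ?inE.
rewrite -(fineK (fin _ p1)) -(fineK (fin _ p2)) -(fineK (fin _ n1)).
by rewrite -(fineK (fin _ n2)) -!(EFinN, EFinD); congr EFin; lra.
Qed.

Lemma charge_integralZ c nu psi :
  measurable_fun setT psi -> (exists M, forall x, `|psi x| <= M) ->
  charge_integral (cscale c nu) psi = c * charge_integral nu psi.
Proof.
move=> mpsi psiM.
have [P [N PN]] := Hahn_decomposition nu.
have [p n] := jordan_lty PN.
rewrite (@charge_integralE nu psi _ _ p n)//; last by move=> *; exact: jordanE.
pose c' : {nonneg R} := NngNum (normr_ge0 c).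
have sT (m : {measure set mplane -> \bar R}) : (m setT < +oo)%E ->
    (mscale c' m setT < +oo)%E.
  by move=> mT; rewrite /mscale/= lte_mul_pinfty// lee_fin.
have sI (m : {measure set mplane -> \bar R}) : (m setT < +oo)%E ->
    \int[mscale c' m]_x psi x = `|c| * \int[m]_x psi x.
  move=> mT; rewrite /Rintegral.
  suff -> : (\int[mscale c' m]_x (psi x)%:E = `|c|%:E * \int[m]_x (psi x)%:E)%E.
    by rewrite fineM//; exact/integrable_fin_num/integrable_bounded.
  have /measurable_EFinP mf := mpsi.
  rewrite integralE !ge0_integral_mscale//; last 2 first.
  - exact: measurable_funeneg.
  - exact: measurable_funepos.
  have nfin : (\int[m]_x (fun x => (psi x)%:E)^\- x)%E \is a fin_num.
    apply: integrable_fin_num => //.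
    exact: (integrable_funeneg measurableT (integrable_bounded mT mpsi psiM)).
  have mulB (k : R) (a b : \bar R) : b \is a fin_num ->
      (k%:E * a - k%:E * b = k%:E * (a - b))%E.
    by move=> bf; rewrite muleBr// fin_num_adde_defl// fin_numN.
  by rewrite mulB// -integralE.
have fin A (m : {measure set mplane -> \bar R}) : measurable A ->
    (m setT < +oo)%E -> m A \is a fin_num.
  by move=> mA mT; rewrite ge0_fin_numE// (le_lt_trans _ mT)// le_measure ?inE.
have [c0|c0] := leP 0 c.
  have c'E : c'%:num = c by exact: ger0_norm.
  rewrite (@charge_integralE _ psi (mscale c' (jordan_pos PN))
    (mscale c' (jordan_neg PN)))//; [|exact: sT..|].
    by rewrite !sI// ger0_norm//; lra.
  move=> A mA; rewrite -[LHS]/(c%:E * nu A)%E (jordanE PN)//.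
  rewrite -[RHS]/(c'%:num%:E * jordan_pos PN A - c'%:num%:E * jordan_neg PN A)%E c'E.
  rewrite -(fineK (fin _ _ mA p)) -(fineK (fin _ _ mA n)).
  by rewrite -!(EFinN, EFinD, EFinM); congr EFin; lra.
have c'E : c'%:num = - c by exact: ltr0_norm.
rewrite (@charge_integralE _ psi (mscale c' (jordan_neg PN))
  (mscale c' (jordan_pos PN)))//; [|exact: sT..|].
  by rewrite !sI// ltr0_norm//; lra.
move=> A mA; rewrite -[LHS]/(c%:E * nu A)%E (jordanE PN)//.
rewrite -[RHS]/(c'%:num%:E * jordan_neg PN A - c'%:num%:E * jordan_pos PN A)%E c'E.
rewrite -(fineK (fin _ _ mA p)) -(fineK (fin _ _ mA n)).
by rewrite -!(EFinN, EFinD, EFinM); congr EFin; lra.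
Qed.

(** The charge is the difference of the finite measures with densities [|f|] and [|f| - f]. Since
    the density formula is stated for nonnegative integrands, [psi] is first shifted by its bound
    [M]. *)
Lemma charge_integral_density (mu : {sigma_finite_measure set mplane -> \bar R})
    (f : mplane -> R) (fint : mu.-integrable setT (EFin \o f)) psi :
  measurable_fun setT psi -> (exists M, forall x, `|psi x| <= M) ->
  charge_integral (induced_charge fint) psi = \int[mu]_x (f x * psi x).
Proof.
move=> mpsi [M psiM].
have /measurable_EFinP mf := measurable_int mu fint.
pose g1 x := `|f x|; pose g2 x := `|f x| - f x.
have g1int : mu.-integrable setT (EFin \o g1).
  exact: (integrable_abse fint).
have g2int : mu.-integrable setT (EFin \o g2).
  exact: (integrableB measurableT g1int fint).
have g10 x : (0 <= (EFin \o g1) x)%E by rewrite /= lee_fin normr_ge0.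
have g20 x : (0 <= (EFin \o g2) x)%E by rewrite /= lee_fin subr_ge0 ler_norm.
have M0 : 0 <= M by apply: le_trans (psiM point).
have hgint (g h : mplane -> R) : mu.-integrable setT (EFin \o g) ->
    measurable_fun setT h -> (exists C, forall x, `|h x| <= C) ->
    mu.-integrable setT (EFin \o (fun x => g x * h x)).
  move=> gint mh [C hC]; apply: (integrableMl measurableT gint) => //.
  by exists C; split; rewrite ?num_real// => x Cx y _; rewrite /= (le_trans (hC y))// ltW.
have dE (g : mplane -> R) (gint : mu.-integrable setT (EFin \o g))
    (g0 : forall x, (0 <= (EFin \o g) x)%E) (m := density_measure gint g0) :
    \int[m]_x psi x = \int[mu]_x (g x * psi x).
  have mT : (m setT < +oo)%E by rewrite ltey_eq fin_num_measure.
  have key (h : mplane -> R) : (forall x, 0 <= h x) -> measurable_fun setT h ->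
      \int[m]_x h x = \int[mu]_x (g x * h x).
    move=> h0 mh; rewrite /Rintegral; congr fine.
    rewrite (@ge0_integral_density _ _ _ mu (EFin \o g) (EFin \o h))//.
    - by apply: eq_integral => x _; rewrite EFinM muleC.
    - exact/measurable_EFinP.
  have mpsiM : measurable_fun setT (fun x => psi x + M) by exact: measurable_funD.
  have psiMM : exists C, forall x, `|psi x + M| <= C.
    by exists (M + M) => x; rewrite (le_trans (ler_normD _ _))// lerD// ger0_norm.
  have cMM : exists C, forall x : mplane, `|cst M x| <= C by exists `|M|.
  transitivity (\int[m]_x (psi x + M) - \int[m]_x M).
    rewrite -RintegralB//; last 2 first.
    - exact: integrable_bounded.
    - exact: integrable_bounded.
    by apply: eq_Rintegral => x _; rewrite addrK.
  rewrite !key//; last first.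
    by move=> x; rewrite -lerBlDr sub0r; have := psiM x; rewrite ler_norml => /andP[].
  rewrite -RintegralB//; last 2 first.
  - exact: hgint.
  - exact: (@hgint _ (cst M)).
  by apply: eq_Rintegral => x _; ring.
have psib : exists C, forall x, `|psi x| <= C by exists M.
rewrite (@charge_integralE _ psi (density_measure g1int g10) (density_measure g2int g20))//.
- rewrite !dE -RintegralB//; [|exact: hgint..].
  by apply: eq_Rintegral => x _; rewrite /g1 /g2; ring.
- by rewrite ltey_eq fin_num_measure.
- by rewrite ltey_eq fin_num_measure.
move=> A mA.
rewrite [X in (_ = X - _)%E]density_measureE [X in (_ = _ - X)%E]density_measureE.
rewrite /induced_charge -integralB//; last 2 first.
- exact: integrableS g1int.
- exact: integrableS g2int.
by apply: eq_integral => x _; rewrite /g1 /g2 /= -EFinB; congr EFin; ring.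
Qed.

End charge_integral.

(** * Approximate limits and gradients *)

Section plane_measurability.
Variable R : realType.
Local Notation plane := (R * R)%type.
Local Notation mplane := (measurableTypeR R * measurableTypeR R)%type.

(** What matters is that the index set is countable. The inequalities are strict at [x] and weak at
    [y]: the closed box stays in [A] while its interior already contains [x]. This serves both for
    the measurability of open sets and for covering [Omega] by boxes. *)
Lemma open_rational_box (A : set plane) x : open A -> A x ->
  exists i : rat * rat * nat,
    [/\ `|ratr i.1.1 - x.1| < i.2.+1%:R^-1, `|ratr i.1.2 - x.2| < i.2.+1%:R^-1 &
      forall y, `|ratr i.1.1 - y.1| <= i.2.+1%:R^-1 ->
        `|ratr i.1.2 - y.2| <= i.2.+1%:R^-1 -> A y].
Proof.
move=> oA Ax; have /nbhs_ballP[e /= e0 eA] : nbhs x A by move: oA; rewrite openE; exact.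
have [n] : exists n, 2 * n.+1%:R^-1 < e.
  have [n] := ltr_add_invr (divr_gt0 e0 (ltr0Sn R 1)); rewrite add0r => ne.
  by exists n; rewrite mulrC -ltr_pdivlMr.
set d : R := n.+1%:R^-1 => de.
have d0 : 0 < d by rewrite invr_gt0.
have approx (a : R) : exists q : rat, `|ratr q - a| < d.
  have ad : a - d < a + d by lra.
  have [q] := rat_in_itvoo ad; rewrite in_itv /= => /andP[q1 q2].
  by exists q; rewrite ltr_distl q1.
have [p px] := approx x.1; have [q qx] := approx x.2.
exists (p, q, n); split => // y /=; rewrite -/d => y1 y2; apply: eA; split; rewrite /ball /=.
- rewrite (le_lt_trans (ler_distD (ratr p) _ _))//.
  by rewrite distrC (lt_le_trans (ltr_leD px y1))//; lra.
- rewrite (le_lt_trans (ler_distD (ratr q) _ _))//.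
  by rewrite distrC (lt_le_trans (ltr_leD qx y2))//; lra.
Qed.

Lemma open_measurable_plane (A : set plane) : open A -> measurable (A : set mplane).
Proof.
move=> oA.
pose box (i : rat * rat * nat) : set mplane :=
  (ball (ratr i.1.1 : R) i.2.+1%:R^-1) `*` (ball (ratr i.1.2 : R) i.2.+1%:R^-1).
pose F i : set mplane := if `[< box i `<=` A >] then box i else set0.
have -> : A = \bigcup_i F i.
  apply/seteqP; split => [x Ax|x [i _]]; last first.
    by rewrite /F; case: asboolP => // + boxi; apply.
  have [i [x1 x2 iA]] := open_rational_box oA Ax.
  exists i => //; rewrite /F ifT; first by split.
  by apply/asboolP => y [/= /ltW y1 /ltW y2]; exact: iA.
apply: countable_bigcupT_measurable => // i; rewrite /F; case: ifPn => // _.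
by apply: measurableX; apply: open_measurable; exact: ball_open.
Qed.

Lemma continuous_measurable_plane (f : plane -> R) :
  continuous f -> measurable_fun (setT : set mplane) f.
Proof.
move=> /continuousP cf; apply: (measurability _ (RGenOpens.measurableE R)).
move=> _ [_ [a [b ->] <-]]; rewrite setTI; apply: open_measurable_plane.
exact/cf/interval_open.
Qed.

Lemma measurable_eball (x : plane) r : measurable (eball x r : set mplane).
Proof.
have mc (p : mplane -> R) (c : R) : measurable_fun setT p ->
    measurable_fun setT (fun y => p y - c).
  by move=> mp; exact: measurable_funB.
have m1 := mc fst x.1 measurable_fst; have m2 := mc snd x.2 measurable_snd.
have me : measurable_fun (setT : set mplane) (fun y : plane => enorm (y - x)).
  apply: (measurableT_comp (continuous_measurable_fun (@sqrt_continuous R))).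
  by apply: measurable_funD; apply: measurable_funM.
rewrite (_ : eball x r = setT `&` (fun y => enorm (y - x)) @^-1` `]-oo, r[%classic).
  by apply: me => //; exact: measurable_itv.
by rewrite setTI; apply/seteqP; split => y; rewrite /= in_itv.
Qed.

Lemma measurable_dot (L x : plane) :
  measurable_fun (setT : set mplane) (fun y : plane => dot L (y - x)).
Proof.
have mc (p : mplane -> R) (c : R) : measurable_fun setT p ->
    measurable_fun setT (fun y => p y - c).
  by move=> mp; exact: measurable_funB.
have m1 := mc fst x.1 measurable_fst; have m2 := mc snd x.2 measurable_snd.
by apply: measurable_funD; apply: measurable_funM.
Qed.

End plane_measurability.

(** * Normalised means over shrinking balls: linearity and uniqueness *)

Section mean_limits.
Variable R : realType.
Local Notation plane := (R * R)%type.
Local Notation mplane := (measurableTypeR R * measurableTypeR R)%type.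
Local Notation mu := (@lebesgue_measure R \x @lebesgue_measure R)%E.
Variable Omega : set plane.
Hypothesis Omega_open : open Omega.

Let mOmega : measurable (Omega : set mplane).
Proof. exact: open_measurable_plane. Qed.

Let mOB (x : plane) r : measurable ((Omega `&` eball x r) : set mplane).
Proof. by apply: measurableI => //; exact: measurable_eball. Qed.

(* [approx_lim] and [is_approx_grad] are the instances [k = 2] and [k = 3]. *)
Definition mean_lim0 k (w : plane -> R) (x : plane) : Prop :=
  (((rho ^- k)%:E * \int[mu]_(y in Omega `&` eball x rho) `|w y|%:E)%E
     @[rho --> 0^'+] --> 0%E).

(* [almost_everywhere] is recognised as a filter on [mplane], not on [plane]. *)
Lemma ae_plane1 (P Q : mplane -> Prop) : (forall x, P x -> Q x) ->
  {ae mu, forall x, P x} -> {ae mu, forall x, Q x}.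
Proof. by move=> PQ; exact: filterS. Qed.

Lemma ae_plane2 (P Q T : mplane -> Prop) : (forall x, P x -> Q x -> T x) ->
  {ae mu, forall x, P x} -> {ae mu, forall x, Q x} -> {ae mu, forall x, T x}.
Proof. by move=> PQT; exact: filterS2. Qed.

(** The hypothesis is a pointwise domination rather than an identity, so that the triangle
    inequality yields from it the linearity of approximate limits and gradients and also, applied to
    the difference of two candidates, their uniqueness. *)
Lemma mean_lim0_comb k (f g h : mplane -> R) a b x :
  measurable_fun Omega f -> measurable_fun Omega g -> measurable_fun Omega h ->
  (forall y, Omega y -> `|h y| <= a * `|f y| + b * `|g y|) -> 0 <= a -> 0 <= b ->
  mean_lim0 k f x -> mean_lim0 k g x -> mean_lim0 k h x.
Proof.
move=> mf mg mh hfg a0 b0 Lf Lg.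
have mabs (w : mplane -> R) r : measurable_fun Omega w ->
    measurable_fun (Omega `&` eball x r) (fun y => `|w y|%:E).
  move=> mw; apply/measurable_EFinP/measurableT_comp => //.
  exact: measurable_funS mw.
have Lab : (a%:E * ((rho ^- k)%:E * \int[mu]_(y in Omega `&` eball x rho) `|f y|%:E) +
   b%:E * ((rho ^- k)%:E * \int[mu]_(y in Omega `&` eball x rho) `|g y|%:E))%E
   @[rho --> 0^'+] --> 0%E.
  rewrite [X in _ --> X](_ : 0%E = (a%:E * 0 + b%:E * 0)%E); last first.
    by rewrite !mule0 adde0.
  by apply: cvgeD; [rewrite !mule0|exact: cvgeZl|exact: cvgeZl].
apply: (squeeze_cvge _ (cvg_cst 0%E) Lab).
near=> rho.
have rho0 : 0 < rho by near: rho; exact: nbhs_right_gt.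
have r0 : (0 <= (rho ^- k)%:E)%E by rewrite lee_fin invr_ge0 exprn_ge0// ltW.
apply/andP; split; first by rewrite mule_ge0// integral_ge0// => y _; rewrite lee_fin.
rewrite !muleA ![(_%:E * (rho ^- k)%:E)%E]muleC -!muleA -muleDr//; last first.
  by rewrite ge0_adde_def// inE mule_ge0// integral_ge0.
apply: lee_wpmul2l => //.
rewrite -!ge0_integralZl_EFin//; try exact: mabs.
rewrite -ge0_integralD//; last 4 first.
- by move=> y _; rewrite mule_ge0.
- by apply: measurable_funeM; exact: mabs.
- by move=> y _; rewrite mule_ge0.
- by apply: measurable_funeM; exact: mabs.
apply: ge0_le_integral => //.
- exact: mabs.
- by apply: emeasurable_funD; apply: measurable_funeM; exact: mabs.
- by move=> y [Oy _]; rewrite -!EFinM -EFinD lee_fin hfg.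
Unshelve. all: by end_near. Qed.

(** Points whose distance from [a] lies between [rho / 4] and [rho / 2], to the right or to the left
    according to [s]. Two such intervals bound a square inside the ball of radius [rho], in a
    prescribed quadrant and away from the axes through the centre. *)
Let side (s : bool) (a rho : R) : set R :=
  if s then `[a + rho / 4, a + rho / 2]%classic
  else `[a - rho / 2, a - rho / 4]%classic.

Let sideP s a rho y : 0 < rho -> side s a rho y ->
  exists t : R, [/\ rho / 4 <= t, t <= rho / 2 & y - a = (-1) ^+ (~~ s) * t].
Proof.
move=> rho0; rewrite /side; case: s; rewrite /= in_itv /= => /andP[y1 y2].
- by exists (y - a); split; [lra|lra|rewrite expr0; lra].
- by exists (a - y); split; [lra|lra|rewrite expr1; lra].
Qed.

Let mside s a rho : measurable (side s a rho : set (measurableTypeR R)).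
Proof. by rewrite /side; case: s; exact: measurable_itv. Qed.

Let muside s a rho : 0 < rho -> lebesgue_measure (side s a rho) = (rho / 4)%:E.
Proof.
move=> rho0; rewrite /side; case: s; rewrite lebesgue_measure_itv /= lte_fin ifT.
- by rewrite -EFinB; congr EFin; lra.
- by lra.
- by rewrite -EFinB; congr EFin; lra.
- by lra.
Qed.

(** The square has area [rho ^+ 2 / 16] and lies in [Omega] and in the ball for small [rho], so the
    normalised integrals stay above [delta / 16]. *)
Lemma mean_lim0_lower m (w : mplane -> R) (x : plane) s1 s2 delta : Omega x ->
  measurable_fun Omega w -> 0 < delta ->
  (forall rho y, 0 < rho -> side s1 x.1 rho y.1 -> side s2 x.2 rho y.2 ->
     delta * rho ^+ m <= `|w y|) ->
  ~ mean_lim0 m.+2 w x.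
Proof.
move=> Ox mw delta0 wlb Lw.
have /nbhs_ballP[e /= e0 eO] : nbhs x Omega by move: Omega_open; rewrite openE; exact.
suff : ((delta / 16)%:E <= 0)%E by rewrite lee_fin leNgt divr_gt0.
rewrite -(cvg_lim _ Lw)//; apply: lime_ge; first by apply: cvgP Lw.
near=> rho.
have rho0 : 0 < rho by near: rho; exact: nbhs_right_gt.
have rhoe : rho < e by near: rho; exact: nbhs_right_lt.
pose B : set mplane := side s1 x.1 rho `*` side s2 x.2 rho.
have mB : measurable B by exact: measurableX.
have BO : B `<=` Omega `&` eball x rho.
  move=> y [y1 y2].
  have [t1 [t11 t12 yt1]] := sideP rho0 y1; have [t2 [t21 t22 yt2]] := sideP rho0 y2.
  have nt s t : 0 <= t -> `|(-1) ^+ s * t : R| = t.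
    by move=> t0; rewrite normrM normrX normrN1 expr1n mul1r ger0_norm.
  split.
    apply: eO; split; rewrite /ball /= distrC ?yt1 ?yt2 nt; lra.
  rewrite /eball /= /enorm /dot.
  rewrite -[X in _ < X](ger0_norm (ltW rho0)) -sqrtr_sqr ltr_sqrt ?exprn_gt0//.
  rewrite /= yt1 yt2 -!expr2 !exprMn -!exprM !(mulnC _ 2) !exprM sqrrN expr1n !expr1n.
  rewrite !mul1r; nra.
apply: (@le_trans _ _ ((rho ^- m.+2)%:E * \int[mu]_(y in B) (delta * rho ^+ m)%:E)%E).
  have muB : mu B = ((rho / 4)%:E * (rho / 4)%:E)%E.
    rewrite -[X in (X * _)%E](muside s1 x.1)// -[X in (_ * X)%E](muside s2 x.2)//.
    exact: product_measure1E.
  have -> : (\int[mu]_(_ in B) (delta * rho ^+ m)%:E = (delta * rho ^+ m)%:E * mu B)%E.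
    exact: integral_cst.
  rewrite muB -!EFinM lee_fin.
  rewrite (_ : rho ^- m.+2 * _ = delta / 16)// !exprS; field.
  by rewrite expf_neq0 ?gt_eqF.
apply: lee_wpmul2l; first by rewrite lee_fin invr_ge0 exprn_ge0// ltW.
have mabs D : measurable D -> D `<=` Omega -> measurable_fun D (fun y => `|w y|%:E).
  move=> mD DO; apply/measurable_EFinP/measurableT_comp => //.
  exact: measurable_funS mw.
apply: (@le_trans _ _ (\int[mu]_(y in B) `|w y|%:E)%E).
  apply: ge0_le_integral => //.
  - by move=> y _; rewrite lee_fin mulr_ge0 ?exprn_ge0// ltW.
  - by apply: mabs => // y /BO[].
  - by move=> y [y1 y2]; rewrite lee_fin wlb.
apply: ge0_subset_integral => //.
by apply: mabs; [exact: mOB|exact: subIsetl].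
Unshelve. all: by end_near. Qed.

Lemma mean_lim0_cst_eq0 c x : Omega x -> mean_lim0 2 (cst c) x -> c = 0.
Proof.
move=> Ox Lc; have [//|c0] := eqVneq c 0; exfalso; move: Lc.
apply: (@mean_lim0_lower 0 _ x true true `|c|) => //; first by rewrite normr_gt0.
by move=> rho y _ _ _; rewrite expr0 mulr1.
Qed.

(** The quadrant is chosen by the signs of the components of [L]. Both terms of the scalar product
    are then nonnegative on the square and add up to at least [(|L.1| + |L.2|) * rho / 4]. *)
Lemma mean_lim0_linear_eq0 (L x : plane) : Omega x ->
  mean_lim0 3 (fun y => dot L (y - x)) x -> L = 0.
Proof.
move=> Ox LL; apply: contrapT => L0.
have nL : 0 < `|L.1| + `|L.2|.
  rewrite lt_def addr_ge0 ?normr_ge0// andbT.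
  apply: contra_notN L0; rewrite paddr_eq0 ?normr_ge0// !normr_eq0.
  by rewrite {3}(surjective_pairing L) => /andP[/eqP-> /eqP->].
apply: (@mean_lim0_lower 1 _ x (0 <= L.1) (0 <= L.2) ((`|L.1| + `|L.2|) / 4) _ _ _ _ LL) => //.
- by apply: measurable_funTS; exact: measurable_dot.
- lra.
move=> rho y rho0 y1 y2.
have [t1 [t11 _ yt1]] := sideP rho0 y1; have [t2 [t21 _ yt2]] := sideP rho0 y2.
rewrite /dot /= yt1 yt2 expr1.
have sgnE (a : R) : a * (-1) ^+ (~~ (0 <= a)) = `|a|.
  have [a0|a0] := leP 0 a.
    by rewrite expr0 mulr1 ger0_norm.
  by rewrite expr1 mulrN1 ltr0_norm.
rewrite !mulrA !sgnE; apply: le_trans (ler_norm _).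
have := normr_ge0 L.1; have := normr_ge0 L.2; nra.
Qed.

Lemma mean_lim0_ae0 k (w : mplane -> R) x : measurable_fun Omega w ->
  {ae mu, forall y, Omega y -> w y = 0} -> mean_lim0 k w x.
Proof.
move=> mw w0; rewrite /mean_lim0.
suff E rho : (\int[mu]_(y in Omega `&` eball x rho) `|w y|%:E = 0)%E.
  by under eq_cvg do rewrite E mule0; exact: (cvg_cst (0%E : \bar R)).
rewrite (ae_eq_integral (cst 0%E))//; first by rewrite integral0.
- apply/measurable_EFinP/measurableT_comp => //.
  exact: measurable_funS mw.
- by apply: ae_plane1 w0 => y w0 [Oy _] /=; rewrite w0// normr0.
Qed.

Section approximate_gradient.
Implicit Types (u v : plane -> R) (x L M : plane).

Lemma approx_lim_comb u v a b x z w :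
  measurable_fun (Omega : set mplane) u -> measurable_fun (Omega : set mplane) v ->
  approx_lim Omega u x z -> approx_lim Omega v x w ->
  approx_lim Omega (fun y => a * u y + b * v y) x (a * z + b * w).
Proof.
move=> mu_ mv uz vw.
apply: (@mean_lim0_comb 2 (fun y => u y - z) (fun y => v y - w) _ `|a| `|b|) => //.
- exact: measurable_funB.
- exact: measurable_funB.
- by apply: measurable_funB => //; apply: measurable_funD => //; exact: measurable_funM.
- move=> y _; rewrite -!normrM -[X in X <= _]/(`|a * u y + b * v y - (a * z + b * w)|).
  by rewrite (_ : _ - _ = a * (u y - z) + b * (v y - w)) ?ler_normD//; ring.
Qed.

Lemma approx_lim_unique u x z z' : measurable_fun (Omega : set mplane) u ->
  Omega x -> approx_lim Omega u x z -> approx_lim Omega u x z' -> z = z'.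
Proof.
move=> mu_ Ox uz uz'; apply/eqP; rewrite -subr_eq0; apply/eqP.
apply: (@mean_lim0_cst_eq0 _ x) => //.
apply: (@mean_lim0_comb 2 (fun y => u y - z) (fun y => u y - z') _ 1 1) => //.
- exact: measurable_funB.
- exact: measurable_funB.
move=> y _; rewrite !mul1r /= -[X in _ <= X + _]normrN.
by rewrite (_ : z - z' = - (u y - z) + (u y - z')) ?ler_normD//; ring.
Qed.

Lemma is_approx_grad_comb u v a b x L M :
  measurable_fun (Omega : set mplane) u -> measurable_fun (Omega : set mplane) v ->
  is_approx_grad Omega u x L -> is_approx_grad Omega v x M ->
  is_approx_grad Omega (fun y => a * u y + b * v y) x
    (a * L.1 + b * M.1, a * L.2 + b * M.2).
Proof.
move=> mu_ mv [z uz uL] [w vw vM].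
exists (a * z + b * w); first exact: approx_lim_comb.
have mB (f : mplane -> R) c L' : measurable_fun Omega f ->
    measurable_fun (Omega : set mplane) (fun y => f y - c - dot L' (y - x)).
  move=> mf; apply: measurable_funB; first exact: measurable_funB.
  by apply: measurable_funTS; exact: measurable_dot.
apply: (@mean_lim0_comb 3 _ _ _ `|a| `|b| _ _ _ _ _ _ _ uL vM) => //.
- exact: mB.
- exact: mB.
- by apply: mB; apply: measurable_funD => //; exact: measurable_funM.
- move=> y _; rewrite -!normrM.
  set l := (X in `|X| <= _).
  rewrite (_ : l = a * (u y - z - dot L (y - x)) + b * (v y - w - dot M (y - x))).
    exact: ler_normD.
  by rewrite /l /dot /=; ring.
Qed.

Lemma is_approx_grad_unique u x L M : measurable_fun (Omega : set mplane) u ->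
  Omega x -> is_approx_grad Omega u x L -> is_approx_grad Omega u x M -> L = M.
Proof.
move=> mu_ Ox [z uz uL] [w uw uM].
have zw := approx_lim_unique mu_ Ox uz uw; rewrite -{}zw in uw uM.
apply/eqP; rewrite -subr_eq0; apply/eqP; apply: (@mean_lim0_linear_eq0 _ x) => //.
have mB c L' : measurable_fun (Omega : set mplane) (fun y => u y - c - dot L' (y - x)).
  apply: measurable_funB; first exact: measurable_funB.
  by apply: measurable_funTS; exact: measurable_dot.
apply: (@mean_lim0_comb 3 _ _ _ 1 1 _ _ _ _ _ _ _ uL uM) => //.
- exact: mB.
- exact: mB.
- by apply: measurable_funTS; exact: measurable_dot.
- move=> y _; rewrite !mul1r -[X in _ <= X + _]normrN.
  rewrite (_ : dot (L - M) _ = - (u y - z - dot L (y - x)) + (u y - z - dot M (y - x))).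
    exact: ler_normD.
  by rewrite /dot /=; ring.
Qed.

Lemma approx_gradE u x L : measurable_fun (Omega : set mplane) u -> Omega x ->
  is_approx_grad Omega u x L -> approx_grad Omega u x = L.
Proof.
move=> mu_ Ox uL; rewrite /approx_grad.
by case: xgetP => [M _ uM|/(_ L)//]; exact: is_approx_grad_unique uM uL.
Qed.

Lemma is_approx_grad_ae0 u x : measurable_fun (Omega : set mplane) u ->
  {ae mu, forall y, Omega y -> u y = 0} -> is_approx_grad Omega u x 0.
Proof.
move=> mu_ u0; exists 0.
  apply: (@mean_lim0_ae0 2); first exact: measurable_funB.
  by apply: ae_plane1 u0 => y u0 Oy; rewrite u0// subr0.
apply: (@mean_lim0_ae0 3).
  apply: measurable_funB; first exact: measurable_funB.
  by apply: measurable_funTS; exact: measurable_dot.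
by apply: ae_plane1 u0 => y u0 Oy; rewrite u0// /dot !mul0r !(addr0, subr0).
Qed.

End approximate_gradient.
End mean_limits.

(** * Hausdorff measure and combinations of SBV functions *)

Lemma countableU T (A B : set T) : countable A -> countable B -> countable (A `|` B).
Proof.
move=> cA cB; rewrite -bigcup2E; apply: bigcup_countable => //.
by move=> [|[|n]] _ //=; exact: countable0.
Qed.

Section hausdorff.
Variable R : realType.
Implicit Types A B : set (R * R).

Lemma ediam_ge0 A : (0 <= ediam A)%E.
Proof. by rewrite /ediam le_max lexx. Qed.

Lemma hausdorff1_pre_ge0 delta A : (0 <= hausdorff1_pre delta A)%E.
Proof.
by apply/ereal_infP => _ [C _ <-]; apply: nneseries_ge0 => k _ _; exact: ediam_ge0.
Qed.

Lemma hausdorff1_ge0 A : (0 <= hausdorff1 A)%E.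
Proof.
apply: le_trans (hausdorff1_pre_ge0 1 A) _; apply: ereal_sup_ubound.
by exists 1 => //=.
Qed.

Lemma le_hausdorff1 A B : A `<=` B -> (hausdorff1 A <= hausdorff1 B)%E.
Proof.
move=> AB; apply: ub_ereal_sup => _ [delta d0 <-].
apply: (@le_trans _ _ (hausdorff1_pre delta B)); last first.
  by apply: ereal_sup_ubound; exists delta.
by apply: ereal_inf_le_tmp => _ [C [BC Cd] <-]; exists C => //; split => //; exact: subset_trans BC.
Qed.

Lemma hausdorff1_set0 : hausdorff1 (set0 : set (R * R)) = 0%E.
Proof.
apply/eqP; rewrite eq_le hausdorff1_ge0 andbT.
apply: ub_ereal_sup => _ [delta d0 <-]; apply: ereal_inf_lbound.
have ed0 : ediam (set0 : set (R * R)) = 0%E.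
  by rewrite /ediam set0X image_set0 ereal_sup0 maxeNy.
exists (fun=> set0); last by rewrite eseries0// => k _ _; rewrite ed0.
by split => // k; rewrite ed0 lee_fin ltW.
Qed.

(** Coverings of two sets, placed at the even and the odd indices, make one covering of the union;
    this bounds its cost. *)
Lemma nneseries_interleave (c d : nat -> \bar R) :
  (forall k, 0 <= c k)%E -> (forall k, 0 <= d k)%E ->
  (\sum_(0 <= k <oo) (if odd k then d k./2 else c k./2) <=
   \sum_(0 <= k <oo) c k + \sum_(0 <= k <oo) d k)%E.
Proof.
move=> c0 d0; set e := fun k => if odd k then d k./2 else c k./2.
have e0 k : (0 <= e k)%E by rewrite /e; case: ifP.
apply: lime_le; first by apply: is_cvg_nneseries => k _ _; exact: e0.
apply: nearW => n.
have e2n m : (\sum_(0 <= k < m.*2) e k = \sum_(0 <= k < m) c k + \sum_(0 <= k < m) d k)%E.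
  elim: m => [|m IH]; first by rewrite !big_geq// adde0.
  rewrite doubleS !(@big_nat_recr _ _ _ _ 0%N)//= IH /e /= odd_double /=.
  by rewrite doubleK uphalf_double -addeA addeACA.
apply: (@le_trans _ _ (\sum_(0 <= k < n.*2) e k)%E).
  apply: lee_sum_nneg_natr => //; first by move=> k _ _; exact: e0.
  by rewrite -addnn leq_addr.
by rewrite e2n leeD//; apply: nneseries_lim_ge.
Qed.

Lemma hausdorff1_preU delta A B : (hausdorff1_pre delta (A `|` B) <=
  hausdorff1_pre delta A + hausdorff1_pre delta B)%E.
Proof.
have [->|Aoo] := eqVneq (hausdorff1_pre delta A) +oo%E.
  by rewrite addye ?leey// gt_eqF// (lt_le_trans _ (hausdorff1_pre_ge0 _ _)).
have [->|Boo] := eqVneq (hausdorff1_pre delta B) +oo%E.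
  by rewrite addey ?leey// gt_eqF// (lt_le_trans _ (hausdorff1_pre_ge0 _ _)).
have fin X : hausdorff1_pre delta X != +oo%E -> hausdorff1_pre delta X \is a fin_num.
  by move=> Xoo; rewrite ge0_fin_numE ?hausdorff1_pre_ge0// ltey.
apply/lee_addgt0Pr => e e0.
have e20 : 0 < e / 2 by rewrite divr_gt0.
have [_ [C [AC Cd] <-] Ce] := lb_ereal_inf_adherent e20 (fin _ Aoo).
have [_ [D [BD Dd] <-] De] := lb_ereal_inf_adherent e20 (fin _ Boo).
apply: (@le_trans _ _ (\sum_(0 <= k <oo) ediam (C k) + \sum_(0 <= k <oo) ediam (D k))%E).
  apply: le_trans (nneseries_interleave _ _); try by move=> k; exact: ediam_ge0.
  apply: ereal_inf_lbound; exists (fun k => if odd k then D k./2 else C k./2).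
    split; last by move=> k; case: ifP.
    move=> x [/AC[k _ Ckx]|/BD[k _ Dkx]].
      by exists k.*2 => //; rewrite odd_double doubleK.
    by exists k.*2.+1 => //=; rewrite odd_double uphalf_double.
  by apply: eq_eseriesr => k _; case: ifP.
apply: le_trans (leeD (ltW Ce) (ltW De)) _.
by rewrite addeACA -EFinD -splitr.
Qed.

Lemma hausdorff1U A B : (hausdorff1 (A `|` B) <= hausdorff1 A + hausdorff1 B)%E.
Proof.
apply: ub_ereal_sup => _ [delta d0 <-]; apply: le_trans (hausdorff1_preU _ _ _) _.
by apply: leeD; apply: ereal_sup_ubound; exists delta.
Qed.

Lemma hausdorff1_null_sub A B : A `<=` B -> hausdorff1 B = 0%E -> hausdorff1 A = 0%E.
Proof.
by move=> AB B0; apply/eqP; rewrite eq_le hausdorff1_ge0 andbT -B0 le_hausdorff1.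
Qed.

Lemma hausdorff1_nullU A B : hausdorff1 A = 0%E -> hausdorff1 B = 0%E ->
  hausdorff1 (A `|` B) = 0%E.
Proof.
move=> A0 B0; apply/eqP; rewrite eq_le hausdorff1_ge0 andbT.
by rewrite (le_trans (hausdorff1U _ _))// A0 B0 adde0.
Qed.

(** Only the null set [B] minus [A] is new. This is what keeps the length term of a competitor from
    exceeding that of [u]. *)
Lemma hausdorff1_U_h1_subset A B : h1_subset B A ->
  (hausdorff1 (A `|` B) <= hausdorff1 A)%E.
Proof.
rewrite /h1_subset => BA; apply: (@le_trans _ _ (hausdorff1 (A `|` (B `\` A)))).
  apply: le_hausdorff1 => x [Ax|Bx]; first by left.
  by have [Ax|nAx] := pselect (A x); [left|right].
by apply: le_trans (hausdorff1U _ _) _; rewrite BA adde0.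
Qed.

End hausdorff.

Import HBNNSimple.

(** The function [h] may be non-measurable: the integral of a nonnegative function is a supremum
    over simple functions below it, and each of these is almost everywhere below [g]. The intended
    [h] is the squared approximate gradient of a linear combination. *)
Lemma le_integral_off_null d (T : measurableType d) (R : realType)
    (mu : {measure set T -> \bar R}) (D : set T) (h g : T -> \bar R) :
  measurable D -> measurable_fun D g -> (forall x, D x -> 0 <= g x)%E ->
  (forall x, D x -> 0 <= h x)%E ->
  {ae mu, forall x, D x -> (h x <= g x)%E} ->
  (\int[mu]_(x in D) h x <= \int[mu]_(x in D) g x)%E.
Proof.
move=> mD mg g0 h0 hg; rewrite integral_mkcond [leRHS]integral_mkcond.
have gD0 x : (0 <= (g \_ D) x)%E.
  by rewrite /patch; case: ifPn => //; rewrite inE; exact: g0.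
rewrite ge0_integralTE; last first.
  by move=> x; rewrite /patch; case: ifPn => //; rewrite inE; exact: h0.
apply: ub_ereal_sup => _ [s /= sh <-]; rewrite -integralT_nnsfun.
apply: ae_ge0_le_integral => //.
- by move=> x _; rewrite lee_fin; exact: fun_ge0.
- exact/measurable_EFinP.
- exact/(measurable_restrictT _ _).1.
apply: filterS hg => x hgx _; apply: le_trans (sh x) _.
by rewrite /patch; case: ifPn => //; rewrite inE; exact: hgx.
Qed.

(** Cramer's rule, here and in [solve_snd]: two combinations with the same [a] and different second
    coefficients determine both functions. *)
Lemma solve_fst (R : realFieldType) (a i j U V : R) : a != 0 -> i - j != 0 ->
  U = - j / (a * (i - j)) * (a * U + i * V) + i / (a * (i - j)) * (a * U + j * V).
Proof. by move=> a0 ij; field; rewrite ij a0. Qed.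

Lemma solve_snd (R : realFieldType) (a i j U V : R) : i - j != 0 ->
  V = (i - j)^-1 * (a * U + i * V) + - (i - j)^-1 * (a * U + j * V).
Proof. by move=> ij; field. Qed.

(** * Cantor parts of linear combinations *)

Section sbv.
Variable R : realType.
Local Notation plane := (R * R)%type.
Local Notation mplane := (measurableTypeR R * measurableTypeR R)%type.
Local Notation mu := (@lebesgue_measure R \x @lebesgue_measure R)%E.
Variable Omega : set plane.
Hypothesis Omega_open : open Omega.
Implicit Types (u v phi : plane -> R) (e x : plane).

Let mOmega : measurable (Omega : set mplane).
Proof. exact: open_measurable_plane. Qed.

Lemma restrict_comb u v a b : (fun y => a * u y + b * v y) \_ Omega =
  a *: (u \_ Omega) + b *: (v \_ Omega).
Proof.
apply/funext => y; rewrite /patch !fctE /=.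
by case: ifP => _; rewrite // /GRing.scale /= !mulr0 addr0.
Qed.

Lemma inL1_measurable u : inL1 Omega u -> measurable_fun (Omega : set mplane) u.
Proof.
move=> /sub_Lfun_mfun; rewrite inE => mu_.
exact/(@measurable_restrictT _ _ mplane R).
Qed.

Lemma inL2_comb u v a b : inL2 Omega u -> inL2 Omega v ->
  inL2 Omega (fun y => a * u y + b * v y).
Proof.
by move=> uL vL; rewrite /inL2 restrict_comb; exact: (Lfun2D (Lfun2Z a uL) (Lfun2Z b vL)).
Qed.

Lemma inL1_comb u v a b : inL1 Omega u -> inL1 Omega v ->
  inL1 Omega (fun y => a * u y + b * v y).
Proof.
move=> uL vL; rewrite /inL1 restrict_comb.
have := @Lfun_submod_closed _ _ _ mu 1%:E (lexx _).
move=> [L0 LD]; have aL : a *: (u \_ Omega) \in Lfun mu 1%:E.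
  by rewrite -[_ *: _]addr0 LD.
by rewrite addrC LD.
Qed.

Lemma h1_subset_comb S u v a b :
  measurable_fun (Omega : set mplane) u -> measurable_fun (Omega : set mplane) v ->
  h1_subset (jump_set Omega u) S -> h1_subset (jump_set Omega v) S ->
  h1_subset (jump_set Omega (fun y => a * u y + b * v y)) S.
Proof.
move=> mu_ mv uS vS; apply: hausdorff1_null_sub (hausdorff1_nullU uS vS).
move=> x [[Ox nx] Sx]; have [ux|ux] := pselect (exists z, approx_lim Omega u x z).
  have [vx|vx] := pselect (exists z, approx_lim Omega v x z).
    exfalso; apply: nx; move: ux vx => [z uz] [w vw].
    by exists (a * z + b * w); exact: approx_lim_comb.
  by right.
by left.
Qed.

Lemma compact_support_bounded (T : topologicalType) (K : set T) (g : T -> R) : compact K ->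
  continuous g -> (forall t, ~ K t -> g t = 0) -> exists M, forall t, `|g t| <= M.
Proof.
move=> cK cg gK; have [M [_ KM]] : bounded_set (g @` K).
  by apply: compact_bounded; apply: continuous_compact => //; exact: continuous_subspaceT.
exists (`|M| + 1) => x; have [Kx|nKx] := pselect (K x).
  by apply: KM; [rewrite (le_lt_trans (ler_norm M))// ltrDl|exists x].
by rewrite gK// normr0 addr_ge0.
Qed.

Lemma test_function_derive (phi : plane -> R) e : test_function Omega phi ->
  [/\ measurable_fun (setT : set mplane) phi,
      measurable_fun (setT : set mplane) (fun x => 'D_e phi x),
      exists M, forall x, `|phi x| <= M & exists M, forall x, `|'D_e phi x| <= M].
Proof.
move=> [[dphi cphi] [K [cK KO] phiK]].
have cphi0 : continuous phi by move=> x; exact/differentiable_continuous/dphi.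
split.
- exact: continuous_measurable_plane.
- exact: continuous_measurable_plane.
- exact: compact_support_bounded cK cphi0 phiK.
apply: (compact_support_bounded cK (cphi e)) => x nKx.
have nbhsK : \forall y \near x, phi y = cst 0 y.
  have : open (~` K).
    by apply: closed_openC; apply: compact_closed => //; exact: norm_hausdorff.
  rewrite openE => /(_ x nKx); apply: filterS => y; exact: phiK.
by rewrite (near_eq_derive e nbhsK)// derive_cst.
Qed.

Lemma distr_derivative_comb u v a b e (nu1 nu2 : {charge set mplane -> \bar R}) :
  inL1 Omega u -> inL1 Omega v ->
  distr_derivative Omega u e nu1 -> distr_derivative Omega v e nu2 ->
  distr_derivative Omega (fun y => a * u y + b * v y) e
    (cadd (cscale a nu1) (cscale b nu2)).
Proof.
move=> uL vL Du Dv phi tphi; have [mphi mdphi bphi [M bdphi]] := test_function_derive e tphi.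
rewrite charge_integralD// !charge_integralZ//.
have Iint w : inL1 Omega w -> mu.-integrable Omega (EFin \o (fun x => w x * 'D_e phi x)).
  move=> /Lfun1_integrable iw.
  have : mu.-integrable Omega ((EFin \o w) \* (EFin \o (fun x => 'D_e phi x)))%E.
    apply: integrableMl => //.
    - rewrite integrable_mkcond//; move: iw; congr (_.-integrable _ _).
      by apply/funext => x; rewrite /patch /=; case: ifP.
    - exact: measurable_funTS.
    by exists M; split; rewrite ?num_real// => c Mc y _; rewrite /= (le_trans (bdphi y))// ltW.
  by [].
transitivity (a * \int[mu]_(x in Omega) (u x * 'D_e phi x) +
              b * \int[mu]_(x in Omega) (v x * 'D_e phi x)).
  rewrite -!RintegralZl//; [|exact: Iint|exact: Iint].
  rewrite -RintegralD//.
  - by apply: eq_Rintegral => x _; ring.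
  - apply: (integrableZl mOmega a (Iint _ uL)).
  - apply: (integrableZl mOmega b (Iint _ vL)).
by rewrite Du// Dv//; ring.
Qed.

(** If [c] is exceptional, one of the singular parts [nus1], [nus2] charges a set on which [w c] has
    approximate limits. On the intersection of such sets for two different [c], both [u] and [v]
    have approximate limits, so neither singular part charges any measurable subset of it.
    Finiteness of the charges leaves countably many exceptional [c]. *)
Lemma countable_not_no_cantor u v a e : a != 0 -> inL1 Omega u -> inL1 Omega v ->
  no_cantor_derivative Omega u e -> no_cantor_derivative Omega v e ->
  countable [set c | ~ no_cantor_derivative Omega (fun y => a * u y + c * v y) e].
Proof.
move=> a0 uL vL [nua1 [nus1 [D1 ac1 s1 z1]]] [nua2 [nus2 [D2 ac2 s2 z2]]].
have mu_ := inL1_measurable uL; have mv := inL1_measurable vL.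
pose w c y := a * u y + c * v y.
have mw c : measurable_fun (Omega : set mplane) (w c).
  by apply: measurable_funD; exact: measurable_funM.
pose good c (A : set mplane) :=
  measurable A /\ A `<=` Omega `\` jump_set Omega (w c).
have good_disj i j (A B C : set mplane) : i != j -> good i A -> good j B ->
    C `<=` A `&` B ->
    C `<=` Omega `\` jump_set Omega u /\ C `<=` Omega `\` jump_set Omega v.
  move=> ij [_ gA] [_ gB] CAB.
  have lim x : C x -> Omega x /\ (exists z, approx_lim Omega u x z) /\
      exists z, approx_lim Omega v x z.
    move=> /CAB[/gA[Ox ni] /gB[_ nj]].
    have [z wz] : exists z, approx_lim Omega (w i) x z.
      by apply: contrapT => nz; apply: ni.
    have [z' wz'] : exists z, approx_lim Omega (w j) x z.
      by apply: contrapT => nz; apply: nj.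
    have ij0 : i - j != 0 by rewrite subr_eq0.
    split => //; split.
    - exists (- j / (a * (i - j)) * z + i / (a * (i - j)) * z').
      rewrite (_ : u = fun y => - j / (a * (i - j)) * w i y + i / (a * (i - j)) * w j y).
        exact: approx_lim_comb.
      by apply/funext => y; exact: solve_fst.
    - exists ((i - j)^-1 * z + - (i - j)^-1 * z').
      rewrite (_ : v = fun y => (i - j)^-1 * w i y + - (i - j)^-1 * w j y).
        exact: approx_lim_comb.
      by apply/funext => y; exact: solve_snd.
  by split => x /lim[Ox [ux vx]]; split => // -[_].
have c1 : countable [set c | exists A, good c A /\ nus1 A != 0%E].
  apply: countable_charge_neq0 => [i A []//|i j A B C ij gA gB mC CAB].
  by apply: z1 => //; exact: (good_disj i j A B C ij gA gB CAB).1.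
have c2 : countable [set c | exists A, good c A /\ nus2 A != 0%E].
  apply: countable_charge_neq0 => [i A []//|i j A B C ij gA gB mC CAB].
  by apply: z2 => //; exact: (good_disj i j A B C ij gA gB CAB).2.
apply: sub_countable (countableU c1 c2); apply: subset_card_le => c.
apply: contra_notP => /not_orP[n1 n2].
exists (cadd (cscale a nua1) (cscale c nua2)), (cadd (cscale a nus1) (cscale c nus2)).
split.
- move=> phi tphi; rewrite (distr_derivative_comb a c uL vL D1 D2)//.
  have [mphi _ bphi _] := test_function_derive e tphi.
  do 20?[rewrite charge_integralD//|rewrite charge_integralZ//]; congr (- _); ring.
- apply/null_content_dominatesP => A mA A0.
  move/null_content_dominatesP : ac1 => /(_ A mA A0) h1.
  move/null_content_dominatesP : ac2 => /(_ A mA A0) h2.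
  by rewrite -[LHS]/(a%:E * nua1 A + c%:E * nua2 A)%E h1 h2 !mule0 adde0.
- move: s1 s2 => [N1 [mN1 N10 s1]] [N2 [mN2 N20 s2]].
  exists (N1 `|` N2); split; [exact: measurableU|exact: null_set_setU|].
  move=> A mA; rewrite setIUr => AN.
  rewrite -[LHS]/(a%:E * nus1 A + c%:E * nus2 A)%E.
  by move: AN; rewrite setU_eq0 => -[/s1-> // /s2->]; rewrite // !mule0 adde0.
- move=> A mA AO; rewrite -[LHS]/(a%:E * nus1 A + c%:E * nus2 A)%E.
  have -> : nus1 A = 0%E.
    by apply/eqP; apply/negPn/negP => A0; apply: n1; exists A.
  have -> : nus2 A = 0%E.
    by apply/eqP; apply/negPn/negP => A0; apply: n2; exists A.
  by rewrite !mule0 adde0.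
Qed.

(* Closedness of SBV under sums is a deeper fact (it rests on the vanishing of
   Du on H^1-finite sets where the approximate limit exists); it is replaced by
   the observation that [a u + c v] is in SBV for all but countably many [c]. *)
Lemma SBV_comb_dense u v a b (e : R) : a != 0 -> SBV Omega u -> SBV Omega v -> 0 < e ->
  exists c, `|b - c| < e /\ SBV Omega (fun y => a * u y + c * v y).
Proof.
move=> a0 [uL u1 u2] [vL v1 v2] e0.
have c1 := countable_not_no_cantor a0 uL vL u1 v1.
have c2 := countable_not_no_cantor a0 uL vL u2 v2.
have [c [bc nc]] : exists c, `|b - c| < e /\
    ~ ([set c | ~ no_cantor_derivative Omega (fun y => a * u y + c * v y) (1, 0)] `|`
       [set c | ~ no_cantor_derivative Omega (fun y => a * u y + c * v y) (0, 1)]) c.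
  apply: contrapT => /forallNP h.
  (* Otherwise the interval of radius [e] around [b] would lie in a countable set, hence be Lebesgue
     null. *)
  have := countable_lebesgue_measure0 (countableU c1 c2).
  apply/eqP; rewrite gt_eqF//.
  apply: (@lt_le_trans _ _ (lebesgue_measure `]b - e, b + e[%classic)).
    rewrite lebesgue_measure_itv /= lte_fin ifT ?lee_fin; last by lra.
    by rewrite -EFinB lte_fin; lra.
  apply: le_outer_measure => c /=; rewrite in_itv /= => /andP[be eb].
  have /not_andP[|/contrapT//] := h c.
  by rewrite ltr_distlC be eb.
move/not_orP : nc => [/contrapT n1 /contrapT n2].
exists c; split; first exact: bc.
by split; [exact: inL1_comb|exact: n1|exact: n2].
Qed.

End sbv.

(** * Bounded functionals from the slope *)

Section slope.
Variable R : realType.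
Local Notation plane := (R * R)%type.
Local Notation mplane := (measurableTypeR R * measurableTypeR R)%type.
Local Notation mu := (@lebesgue_measure R \x @lebesgue_measure R)%E.
Variable Omega : set plane.
Hypothesis Omega_open : open Omega.
Implicit Types (f g u v phi : plane -> R) (S : set plane).

Let mOmega : measurable (Omega : set mplane).
Proof. exact: open_measurable_plane. Qed.

Definition ipO f g : R := @ip _ mplane R mu (f \_ Omega) (g \_ Omega).

Lemma L2dotE f g : L2dot Omega f g = ipO f g.
Proof.
rewrite /L2dot /ipO /ip Rintegral_mkcond; apply: eq_Rintegral => x _.
by rewrite /patch; case: ifP => // _; rewrite mulr0.
Qed.

Lemma ipO_integrable f g : inL2 Omega f -> inL2 Omega g ->
  mu.-integrable Omega (fun x => (f x * g x)%:E).
Proof.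
move=> fL gL; rewrite integrable_mkcond//; have := ip_integrable fL gL.
congr (_.-integrable _ _); apply/funext => x; rewrite /patch.
by case: ifP => // _; rewrite mulr0.
Qed.

Lemma EFin_ipO f g : inL2 Omega f -> inL2 Omega g ->
  (\int[mu]_(x in Omega) (f x * g x)%:E)%E = (ipO f g)%:E.
Proof.
move=> fL gL; rewrite -L2dotE /L2dot /Rintegral fineK//.
by apply: integrable_fin_num => //; exact: ipO_integrable.
Qed.

Lemma L2dotvE (f g : plane -> plane) :
  inL2 Omega (fun x => (f x).1) -> inL2 Omega (fun x => (f x).2) ->
  inL2 Omega (fun x => (g x).1) -> inL2 Omega (fun x => (g x).2) ->
  L2dotv Omega f g = ipO (fun x => (f x).1) (fun x => (g x).1) +
                     ipO (fun x => (f x).2) (fun x => (g x).2).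
Proof.
move=> f1 f2 g1 g2; rewrite /L2dotv -!L2dotE /L2dot -RintegralD//.
- exact: ipO_integrable.
- exact: ipO_integrable.
Qed.

Lemma L2normE f : inL2 Omega f -> L2norm Omega f = (Num.sqrt (ipO f f))%:E.
Proof. by move=> fL; rewrite /L2norm (Lnorm2E fL). Qed.

Lemma inL2_measurable f : inL2 Omega f -> measurable_fun (Omega : set mplane) f.
Proof.
move=> /Lfun2_measurable mf.
exact/(@measurable_restrictT _ _ mplane R).
Qed.

Lemma restrict_Lfun2 (f : mplane -> R) : f \in Lfun mu 2%:E ->
  inL2 Omega f /\ ipO f f <= ip mu f f.
Proof.
move=> fL; have mf := Lfun2_measurable fL.
have le : (\int[mu]_x ((f \_ Omega) x * (f \_ Omega) x)%:E <= (ip mu f f)%:E)%E.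
  rewrite EFin_ip//; apply: ge0_le_integral => //.
  - by move=> x _; rewrite lee_fin -expr2 sqr_ge0.
  - apply/measurable_EFinP; apply: measurable_funM;
    apply/(measurable_restrictT _ _).1 => //; exact: measurable_funTS.
  - by apply/measurable_EFinP; exact: measurable_funM.
  - by move=> x _; rewrite lee_fin /patch; case: ifP => // _; rewrite mul0r -expr2 sqr_ge0.
have fO : inL2 Omega f.
  apply: Lfun2P; last by rewrite (le_lt_trans le)// ltry.
  by apply/(measurable_restrictT _ _).1 => //; exact: measurable_funTS.
by split => //; rewrite -lee_fin /ipO EFin_ip.
Qed.

Definition field := ((plane -> R) * (plane -> R))%type.

(* The approximate gradient is carried along as a second component because
   [approx_grad] of a combination is only a.e. equal to the combination of the
   gradients, hence not obviously measurable; on pairs everything is linear. *)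
Definition grad_pair S (p : (plane -> R) * field) : Prop :=
  [/\ SBV Omega p.1, inL2 Omega p.1, inL2 Omega p.2.1, inL2 Omega p.2.2 &
    {ae mu, forall x, Omega x -> is_approx_grad Omega p.1 x (p.2.1 x, p.2.2 x)} /\
    h1_subset (jump_set Omega p.1) S].

Definition grad_dot (G H : field) : R := ipO G.1 H.1 + ipO G.2 H.2.

Definition gradient u : field :=
  (fun x => (approx_grad Omega u x).1, fun x => (approx_grad Omega u x).2).

Lemma SBV2_grad_pair S u : SBV2 Omega S u -> grad_pair S (u, gradient u).
Proof.
move=> [uS uL [gu gu1 gu2] uJ]; split => //=; split => //.
apply: ae_plane1 gu => x gux Ox; have [L uL'] := gux Ox.
by rewrite -surjective_pairing (approx_gradE Omega_open (inL2_measurable uL) Ox uL').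
Qed.

Lemma comb_pairE (p q : (plane -> R) * field) (a c : R) : a *: p + c *: q =
  (fun y => a * p.1 y + c * q.1 y,
   (fun y => a * p.2.1 y + c * q.2.1 y, fun y => a * p.2.2 y + c * q.2.2 y)).
Proof. by []. Qed.

Lemma grad_pair_comb S (p q : (plane -> R) * field) (a c : R) :
  grad_pair S p -> grad_pair S q ->
  SBV Omega (fun y => a * p.1 y + c * q.1 y) -> grad_pair S (a *: p + c *: q).
Proof.
move=> [pS pL pL1 pL2 [pG pJ]] [qS qL qL1 qL2 [qG qJ]] wS.
have mp := inL2_measurable pL; have mq := inL2_measurable qL.
rewrite comb_pairE; split.
- exact: wS.
- exact: (inL2_comb a c pL qL).
- exact: (inL2_comb a c pL1 qL1).
- exact: (inL2_comb a c pL2 qL2).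
split.
- apply: ae_plane2 pG qG => x pG qG Ox.
  exact: (is_approx_grad_comb Omega_open a c mp mq (pG Ox) (qG Ox)).
- exact: (h1_subset_comb Omega_open a c mp mq pJ qJ).
Qed.

Lemma zero_trace_comb u v a b :
  measurable_fun (Omega : set mplane) u -> measurable_fun (Omega : set mplane) v ->
  zero_trace Omega u -> zero_trace Omega v ->
  zero_trace Omega (fun y => a * u y + b * v y).
Proof.
move=> mu_ mv u0 v0; apply: hausdorff1_null_sub (hausdorff1_nullU u0 v0).
move=> x [bx nx]; have [ux|ux] := pselect (approx_lim Omega u x 0); last by left.
right; split => // vx; apply: nx.
have := approx_lim_comb Omega_open a b mu_ mv ux vx.
by rewrite !mulr0 addr0.
Qed.

(** At a point where [phi] has trace zero, adding [c phi] transports every trace value of [u]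
    unchanged, and adding [- c phi] transports it back. *)
Lemma same_trace_comb u phi c :
  measurable_fun (Omega : set mplane) u -> measurable_fun (Omega : set mplane) phi ->
  zero_trace Omega phi -> same_trace Omega u (fun y => u y + c * phi y).
Proof.
move=> mu_ mphi phi0; apply: hausdorff1_null_sub phi0 => x [bx nx]; split => // phix.
apply: nx => z; split => uz.
- have := approx_lim_comb Omega_open 1 c mu_ mphi uz phix.
  by rewrite mulr0 addr0 mul1r; under eq_fun do rewrite mul1r.
- have mw : measurable_fun (Omega : set mplane) (fun y => u y + c * phi y).
    by apply: measurable_funD => //; exact: measurable_funM.
  have := approx_lim_comb Omega_open 1 (- c) mw mphi uz phix.
  rewrite mulr0 addr0 mul1r (_ : (fun y => _) = u)//.
  by apply/funext => y; rewrite mul1r mulNr addrK.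
Qed.

Lemma ipO_ae0 f g : inL2 Omega f -> inL2 Omega g ->
  {ae mu, forall x, Omega x -> g x = 0} -> ipO f g = 0.
Proof.
move=> fL gL g0; apply: EFin_inj; rewrite -EFin_ipO//.
rewrite (ae_eq_integral (cst 0%E))//; first by rewrite integral0.
- exact: (measurable_int mu (ipO_integrable fL gL)).
- by apply: ae_plane1 g0 => x gx Ox; rewrite gx// mulr0.
Qed.

(** Handles directions of zero norm, for which no difference quotient exists. Such a function
    vanishes almost everywhere, and approximate gradients are blind to null sets, so zero is its
    gradient. *)
Lemma grad_pair_null S p : grad_pair S p -> ipO p.1 p.1 = 0 ->
  forall H : field, inL2 Omega H.1 -> inL2 Omega H.2 -> grad_dot H p.2 = 0.
Proof.
move=> [pS pL pL1 pL2 [pG pJ]] p0 H H1 H2.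
have mp := inL2_measurable pL.
have pae : {ae mu, forall x, Omega x -> p.1 x = 0}.
  have : 'N[mu]_2%:E[EFin \o (p.1 \_ Omega)]%E = 0%E by rewrite (Lnorm2E pL) -/(ipO _ _) p0 sqrtr0.
  move/Lnorm_eq0_eq0 => h.
  have := h ((measurable_EFinP _ _).2 (Lfun2_measurable pL)) _.
  rewrite lte_fin => /(_ (ltr0Sn _ _)).
  by apply: ae_plane1 => x /(_ I) /= [] + Ox; rewrite patchE mem_set.
have Gae : {ae mu, forall x, Omega x -> p.2.1 x = 0 /\ p.2.2 x = 0}.
  apply: ae_plane1 pG => x pG Ox.
  by have [-> ->] := is_approx_grad_unique Omega_open mp Ox (pG Ox) (is_approx_grad_ae0 Omega_open x mp pae).
rewrite /grad_dot !ipO_ae0 ?addr0//.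
- by apply: ae_plane1 Gae => x h Ox; exact: (h Ox).2.
- by apply: ae_plane1 Gae => x h Ox; exact: (h Ox).1.
Qed.

Lemma ipO_ge0 f : 0 <= ipO f f.
Proof. exact: ip_ge0. Qed.

Lemma ipO_quad a b f g : inL2 Omega f -> inL2 Omega g ->
  ipO (fun y => a * f y + b * g y) (fun y => a * f y + b * g y) =
  a ^+ 2 * ipO f f + 2 * a * b * ipO f g + b ^+ 2 * ipO g g.
Proof. by move=> fL gL; rewrite /ipO restrict_comb (ip_quad a b fL gL). Qed.

Lemma integral_sqr_norm (H : field) : inL2 Omega H.1 -> inL2 Omega H.2 ->
  (\int[mu]_(x in Omega) (H.1 x * H.1 x + H.2 x * H.2 x)%:E)%E = (grad_dot H H)%:E.
Proof.
move=> H1 H2; rewrite integralD_EFin//; [|exact: ipO_integrable..].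
by rewrite !EFin_ipO.
Qed.

Lemma mumford_shah_SBV2 S u : SBV2 Omega S u ->
  mumford_shah Omega u S =
  ((grad_dot (gradient u) (gradient u))%:E + hausdorff1 S)%E.
Proof. by move=> [_ _ [_ g1 g2] _]; rewrite -integral_sqr_norm. Qed.

(** An upper bound is enough, because the energy of the competitor enters the slope with a minus
    sign; it also avoids asking whether [approx_grad] of the competitor is measurable. *)
Lemma mumford_shah_le S p : grad_pair S p ->
  (mumford_shah Omega p.1 (S `|` jump_set Omega p.1) <=
   (grad_dot p.2 p.2)%:E + hausdorff1 S)%E.
Proof.
move=> [pS pL pL1 pL2 [pG pJ]].
apply: leeD; last exact: hausdorff1_U_h1_subset.
have m1 := inL2_measurable pL1; have m2 := inL2_measurable pL2.
rewrite -integral_sqr_norm//; apply: le_integral_off_null => //.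
- by apply/measurable_EFinP; apply: measurable_funD; exact: measurable_funM.
- by move=> x _; rewrite lee_fin -!expr2 addr_ge0 ?sqr_ge0.
- by move=> x _; rewrite lee_fin /dot -!expr2 addr_ge0 ?sqr_ge0.
apply: ae_plane1 pG => x pG Ox.
by rewrite (approx_gradE Omega_open (inL2_measurable pL) Ox (pG Ox)).
Qed.

Lemma L2norm_comb_sub u phi c : inL2 Omega phi ->
  L2norm Omega ((fun y => 1 * u y + c * phi y) \- u) =
  (`|c| * Num.sqrt (ipO phi phi))%:E.
Proof.
move=> phiL.
(* The vanishing second term gives the difference the two-term shape of [inL2_comb] and
   [ipO_quad]. *)
rewrite (_ : _ \- u = (fun y => c * phi y + 0 * phi y)); last first.
  by apply/funext => y /=; rewrite mul1r mul0r addr0 addrC addKr.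
have cL : inL2 Omega (fun y => c * phi y + 0 * phi y) by exact: inL2_comb.
rewrite (L2normE cL) ipO_quad// mulr0 mul0r expr0n /= mul0r !addr0.
by rewrite sqrtrM ?sqr_ge0// sqrtr_sqr.
Qed.

(** For a step [c = - t] the energy drops by at least [t * (2 * L - t * K)] over a distance [t * N],
    with [K] the squared norm of the gradient of [p]. Small [t] thus gives quotients close to
    [2 * L / N]. *)
Lemma slope_bound (C : (plane -> R) -> Prop) S u p :
  (hausdorff1 S < +oo)%E -> SBV2 Omega S u ->
  (slope_among Omega C u S < +oo)%E -> grad_pair S p ->
  (forall c, C (fun y => 1 * u y + c * p.1 y)) ->
  2 * grad_dot (gradient u) p.2 <=
  fine (slope_among Omega C u S) * Num.sqrt (ipO p.1 p.1).
Proof.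
move=> Soo uS sloo pS Cp.
have uP := SBV2_grad_pair uS.
have [uSBV uL uG1 uG2 _] := uP; have [pSBV pL pG1 pG2 _] := pS.
have [N0|N0] := eqVneq (ipO p.1 p.1) 0.
  by rewrite (grad_pair_null pS)// N0 sqrtr0 !mulr0.
set sl := slope_among _ _ _ _ in sloo *.
set N := Num.sqrt _; set L := grad_dot _ _.
have Np : 0 < N by rewrite sqrtr_gt0 lt_def N0 ipO_ge0.
have sl0 : (0 <= sl)%E by rewrite /sl /slope_among le_max lexx.
have slfin : sl \is a fin_num by rewrite ge0_fin_numE.
rewrite leNgt; apply/negP => slL.
(* [z] is the limiting rate of descent in the direction opposite to [p]. If it exceeds the slope,
   the midpoint [q] bounds all quotients within some distance [delta], and a competitor with
   quotient at least [q] gives the contradiction. *)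
pose z := 2 * L / N; pose q := (fine sl + z) / 2.
have zE : z * N = 2 * L by rewrite mulfVK// gt_eqF.
have slz : fine sl < z by rewrite -(ltr_pM2r Np) zE.
have slq : fine sl < q by rewrite /q; lra.
have qL : q * N < 2 * L by rewrite -zE (ltr_pM2r Np) /q; lra.
pose K := grad_dot p.2 p.2; have K0 : 0 <= K by rewrite addr_ge0 ?ipO_ge0.
have : (sl < q%:E)%E by rewrite -(fineK slfin) lte_fin.
rewrite {1}/sl /slope_among gt_max => /andP[_].
move=> /ereal_inf_lt[_ [delta /= delta0 <-]].
rewrite ltNge => /negP; apply.
(* The first bound keeps the competitor within [delta], the second makes [t * K] at most
   [2 * L - q * N]. The factors 1/2 leave room for any [t < 2 * t0], and [K + 1] is used because [K]
   may be zero. *)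
pose t0 := Num.min (delta / N / 2) ((2 * L - q * N) / (K + 1) / 2).
have t00 : 0 < t0.
  by rewrite lt_min !divr_gt0// ?subr_gt0//; lra.
have t02 : 0 < t0 / 2 by rewrite divr_gt0.
(* The target coefficient is [- t0], negative because [L > 0] here; only a nearby coefficient is
   known to stay in SBV. *)
have [c [cb cSBV]] := SBV_comb_dense Omega_open (- t0) (oner_neq0 _) uSBV pSBV t02.
pose t := - c; have [tlo thi] : t0 / 2 < t /\ t < 2 * t0.
  by move: cb; rewrite ltr_distl => /andP[]; rewrite /t; lra.
have tp : 0 < t by lra.
have tdelta : t * N < delta.
  have : t0 <= delta / N / 2 by rewrite ge_min lexx.
  have : delta / N * N = delta by rewrite mulfVK// gt_eqF.
  by nra.
have tK : t * K <= 2 * L - q * N.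
  have : t0 <= (2 * L - q * N) / (K + 1) / 2 by rewrite ge_min lexx orbT.
  set y := (2 * L - q * N) / (K + 1).
  have yE : y * (K + 1) = 2 * L - q * N by rewrite mulfVK// gt_eqF//; lra.
  have : 0 < y by rewrite divr_gt0// ?subr_gt0//; lra.
  by nra.
pose v y := 1 * u y + c * p.1 y.
have vP : grad_pair S (1 *: (u, gradient u) + c *: p) by exact: grad_pair_comb.
have vu : L2norm Omega (v \- u) = (t * N)%:E.
  by rewrite L2norm_comb_sub// /t -(ltr0_norm (_ : c < 0))//; move: tp; rewrite /t; lra.
apply: (@le_trans _ _ (maxe 0 (mumford_shah Omega u S -
    mumford_shah Omega v (S `|` jump_set Omega v)) / L2norm Omega (v \- u)%R)%E); last first.
  apply: ereal_sup_ubound; exists v => //; split; [exact: cSBV|exact: Cp|].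
  by rewrite vu !lte_fin tdelta mulr_gt0.
have tN : 0 < t * N by rewrite mulr_gt0.
rewrite vu inver gt_eqF// lee_pdivlMr// le_max; apply/orP; right.
have hfin : hausdorff1 S \is a fin_num by rewrite ge0_fin_numE ?hausdorff1_ge0.
have := mumford_shah_le vP; rewrite comb_pairE /= -/v.
move/(leeB (lexx (mumford_shah Omega u S))); apply: le_trans.
have cancel_h (A B h r : R) : r <= A - B ->
    (r%:E <= (A%:E + h%:E) - (B%:E + h%:E))%E.
  by move=> rAB; rewrite -!EFinD lee_fin; lra.
rewrite (mumford_shah_SBV2 uS) -(fineK hfin) -EFinM; apply: cancel_h.
rewrite {2}/grad_dot /= !ipO_quad//.
rewrite [leRHS](_ : _ = t * (2 * L - t * K)); last first.
  by rewrite /t /L /K /grad_dot /=; ring.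
by rewrite mulrCA ler_pM2l//; move: tK; lra.
Qed.

(** [C] restricts the competitors and [Z] the directions. The pair [same_trace], [zero_trace] treats
    fixed boundary conditions, and the trivial pair treats the slope without them. *)
Lemma riesz_slope (C Z : (plane -> R) -> Prop) S u :
  (hausdorff1 S < +oo)%E -> SBV2 Omega S u ->
  (slope_among Omega C u S < +oo)%E ->
  (forall phi c, inL2 Omega phi -> Z phi -> C (fun y => 1 * u y + c * phi y)) ->
  (forall phi psi a c, inL2 Omega phi -> inL2 Omega psi -> Z phi -> Z psi ->
     Z (fun y => a * phi y + c * psi y)) ->
  exists f, [/\ inL2 Omega f,
    forall p, grad_pair S p -> Z p.1 -> ipO f p.1 = grad_dot (gradient u) p.2 &
    (2%:E * L2norm Omega f <= slope_among Omega C u S)%E].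
Proof.
move=> Soo uS sloo ZC Zcomb.
set sl := slope_among _ _ _ _ in sloo *.
have sl0 : (0 <= sl)%E by rewrite /sl /slope_among le_max lexx.
have slfin : sl \is a fin_num by rewrite ge0_fin_numE.
have [_ _ uG1 uG2 _] := SBV2_grad_pair uS.
pose V : set ((plane -> R) * field) := [set p | grad_pair S p /\ Z p.1].
(* Without admissible directions the zero function represents the functional, and its norm bound
   holds because slopes are nonnegative. *)
have [[p0 Vp0]|V0] := pselect (V !=set0); last first.
  exists (cst 0); split.
  - rewrite /inL2 (_ : cst 0 \_ Omega = 0 *: (u \_ Omega)); last first.
      by apply/funext => x; rewrite /patch; case: ifP => _; rewrite ?scale0r.
    by apply: Lfun2Z; case: uS.
  - by move=> p pS pZ; exfalso; apply: V0; exists p.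
  - rewrite /L2norm (_ : EFin \o _ = cst 0%E) ?Lnorm0 ?mule0//.
    by apply/funext => x; rewrite /patch /=; case: ifP.
have := @riesz_almost_subspace _ mplane R mu _ V (fun p => p.1 \_ Omega)
  (fun p => grad_dot (gradient u) p.2) (fine sl / 2).
case.
- by exists p0.
- by rewrite divr_ge0 ?fine_ge0.
- by move=> a b p q; rewrite comb_pairE restrict_comb.
- by move=> p [[]].
- move=> p q a b e [pS pZ] [qS qZ] a0 e0.
  have [pSBV pL pG1 pG2 _] := pS; have [qSBV qL qG1 qG2 _] := qS.
  have [c [bc cSBV]] := SBV_comb_dense Omega_open b a0 pSBV qSBV e0.
  exists c; split; first exact: bc.
    by split; [exact: grad_pair_comb|exact: (Zcomb _ _ a c pL qL pZ qZ)].
  rewrite comb_pairE /grad_dot /= /ipO !restrict_comb.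
  have ipl f g h : inL2 Omega f -> inL2 Omega g -> inL2 Omega h ->
      @ip _ mplane R mu (h \_ Omega) (a *: (f \_ Omega) + c *: (g \_ Omega)) =
      a * @ip _ mplane R mu (h \_ Omega) (f \_ Omega) + c * @ip _ mplane R mu (h \_ Omega) (g \_ Omega).
    move=> fL gL hL; exact: (ip_combr a c fL gL hL).
  by rewrite !ipl//; ring.
- move=> p [pS pZ]; have [_ pL _ _ _] := pS.
  have := slope_bound Soo uS sloo pS (fun c => ZC _ c pL pZ); rewrite -/sl /ipO.
  lra.
move=> f [fL fV fsl].
(* The representative lives on the whole plane. Restricting it to [Omega] preserves its products
   with functions cut off outside [Omega] and cannot increase its norm. *)
have [fO fle] := restrict_Lfun2 fL.
exists f; split => //.
- move=> p pS pZ; rewrite -(fV p)// /ipO /ip; apply: eq_Rintegral => x _.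
  by rewrite /patch; case: ifP => // _; rewrite !mulr0.
rewrite L2normE// -(fineK slfin) -EFinM lee_fin.
by move: fle => /ler_wsqrtr; move: fsl; lra.
Qed.

End slope.

(** * Product bumps *)

Section ramp.
Variable R : realType.
Implicit Types (t x p q : R).

Definition pos_sqr t : R := Num.max 0 t ^+ 2.

(** A C^1 transition from 0 on the negative axis to 1 at infinity, equal to [1 - 1 / (1 + t^2)] for
    positive [t]. The square in [pos_sqr] removes the corner of the positive part. *)
Definition ramp t : R := 1 - (1 + pos_sqr t)^-1.

(** A quadratic bound on the Taylor remainder can be checked by polynomial inequalities alone,
    including at the point where [pos_sqr] changes formula. *)
Lemma is_derive_remainder (f : R -> R) x df C :
  (forall h, `|f (x + h) - f x - df * h| <= C * h ^+ 2) -> is_derive x 1 f df.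
Proof.
move=> fC; have C0 : 0 <= C.
  by have := fC 1; rewrite expr1n (mulr1 C) => h; exact: le_trans (normr_ge0 _) h.
have D : h^-1 *: (f (h *: 1 + x) - f x) @[h --> 0^'] --> df.
  apply/cvgrPdist_le => e e0; near=> h.
  have h0 : h != 0 by near: h; exact: nbhs_dnbhs_neq.
  have hp : 0 < `|h| by rewrite normr_gt0.
  rewrite [_ *: 1]mulr1 -(ler_pM2l hp) -normrM mulrBr.
  have -> : h * (h^-1 *: (f (h + x) - f x)) = f (h + x) - f x.
    by rewrite -[_ *: _]/(h^-1 * _) mulVKf.
  rewrite distrC (addrC h) [h * df]mulrC (le_trans (fC h))//.
  rewrite -[h ^+ 2]real_normK ?num_real// expr2 mulrCA ler_pM2l//.
  apply: (@le_trans _ _ ((C + 1) * `|h|)); first by rewrite ler_wpM2r// lerDl.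
  rewrite -ler_pdivlMl ?ltr_wpDl//; near: h.
  have d0 : 0 < (C + 1)^-1 * e by rewrite mulr_gt0// invr_gt0 ltr_wpDl.
  apply: nbhs_dnbhs; apply: filterS (nbhs0_le d0) => h; exact.
by apply: DeriveDef; [apply: cvgP D|exact: cvg_lim D].
Unshelve. all: by end_near. Qed.

Lemma is_derive_pos_sqr t : is_derive t 1 pos_sqr (2 * Num.max 0 t).
Proof.
apply: (@is_derive_remainder _ _ _ 1) => h; rewrite /pos_sqr mul1r ler_norml.
have [t0|t0] := leP 0 t; have [th|th] := leP 0 (t + h); apply/andP; split; nra.
Qed.

Lemma pos_sqr_ge0 t : 0 <= pos_sqr t.
Proof. exact: sqr_ge0. Qed.

Definition ramp' t : R := 2 * Num.max 0 t * (1 + pos_sqr t) ^- 2.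

Lemma is_derive_ramp t : is_derive t 1 ramp (ramp' t).
Proof.
have D1 : is_derive t 1 (fun y => 1 + pos_sqr y) (0 + 2 * Num.max 0 t).
  by apply: is_deriveD; exact: is_derive_pos_sqr.
have ne0 : 1 + pos_sqr t != 0 by rewrite gt_eqF// ltr_pwDl// pos_sqr_ge0.
have D2 := is_deriveB (is_derive_cst (1 : R) t 1) (@is_deriveV R (fun y => 1 + pos_sqr y) _ _ _ ne0 D1).
apply: is_derive_eq D2 _; rewrite !add0r scaleNr opprK /ramp'.
by rewrite -[_ *: _]/(_ * _) mulrC.
Qed.

Lemma ramp_ge0 t : 0 <= ramp t.
Proof.
rewrite subr_ge0 invf_le1 ?ltr_pwDl ?pos_sqr_ge0//.
by rewrite lerDl pos_sqr_ge0.
Qed.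

Lemma ramp_le1 t : ramp t <= 1.
Proof. by rewrite gerBl invr_ge0 addr_ge0// pos_sqr_ge0. Qed.

Lemma ramp_eq0 t : t <= 0 -> ramp t = 0.
Proof. by move=> t0; rewrite /ramp /pos_sqr max_l// expr0n addr0 invr1 subrr. Qed.

Lemma cvg_ramp t : 0 < t -> ramp (n%:R * t) @[n --> \oo] --> (1 : R).
Proof.
move=> t0; apply/cvgrPdist_le => e e0; near=> n.
rewrite /ramp opprB addrCA subrr addr0 ger0_norm; last first.
  by rewrite invr_ge0 addr_ge0// pos_sqr_ge0.
have n0 : (0 < n%:R :> R) by rewrite ltr0n; near: n; exact: nbhs_infty_gt.
rewrite /pos_sqr max_r; last by rewrite mulr_ge0// ltW.
have d0 : 0 < 1 + (n%:R * t) ^+ 2 by rewrite ltr_pwDl// sqr_ge0.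
rewrite -[leLHS]mul1r ler_pdivrMr//.
have nte : e^-1 <= n%:R * t.
  rewrite -ler_pdivrMr//; near: n; exact: nbhs_infty_ger.
move: nte; rewrite -(ler_pM2l e0) mulfV ?gt_eqF//.
set s := n%:R * t; have := sqr_ge0 (s - 1); nra.
Unshelve. all: by end_near. Qed.

Lemma continuous_ramp' : continuous ramp'.
Proof.
have cmax t : Num.max 0 y @[y --> t] --> Num.max 0 t.
  by apply: continuous_max; [exact: cvg_cst|exact: cvg_id].
have c1 t : (1 + pos_sqr y) @[y --> t] --> 1 + pos_sqr t.
  by rewrite /pos_sqr; apply: cvgD; [exact: cvg_cst|apply: cvgM; exact: cmax].
move=> t; rewrite /continuous_at /ramp'; apply: cvgM.
  by apply: cvgM; [exact: cvg_cst|exact: cmax].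
apply: cvgV; first by rewrite expf_neq0// gt_eqF// ltr_pwDl// pos_sqr_ge0.
by apply: cvgM; exact: c1.
Qed.

(** For [p < q] the product [(x - p) * (q - x)] is positive exactly between [p] and [q]; the factor
    [n] drives the values there to 1, so the bumps tend to the indicator of the open interval. *)
Definition bump p q (n : nat) x : R := ramp (n%:R * ((x - p) * (q - x))).

Definition bump' p q (n : nat) x : R :=
  ramp' (n%:R * ((x - p) * (q - x))) * (n%:R * (p + q - 2 * x)).

Lemma is_derive_bump p q n x : is_derive x 1 (bump p q n) (bump' p q n x).
Proof.
apply: (@is_derive1_comp _ ramp (fun y => n%:R * ((y - p) * (q - y)))).
  exact: is_derive_ramp.
apply: (@is_derive_remainder _ _ _ n%:R) => h.
rewrite (_ : _ - _ = - (n%:R * h ^+ 2)); last by ring.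
by rewrite normrN ger0_norm// mulr_ge0// sqr_ge0.
Qed.

Lemma continuous_bump' p q n : continuous (bump' p q n).
Proof.
have c1 x : n%:R * ((y - p) * (q - y)) @[y --> x] --> n%:R * ((x - p) * (q - x)).
  apply: cvgM; first exact: cvg_cst.
  by apply: cvgM; apply: cvgB; [exact: cvg_id|exact: cvg_cst|exact: cvg_cst|exact: cvg_id].
move=> x; rewrite /continuous_at /bump'; apply: cvgM.
  by apply: (cvg_comp _ _ (c1 x)); exact: continuous_ramp'.
apply: cvgM; first exact: cvg_cst.
apply: cvgB; first exact: cvg_cst.
by apply: cvgM; [exact: cvg_cst|exact: cvg_id].
Qed.

Lemma bump_eq0 p q n x : p < q -> ~ (p < x < q) -> bump p q n x = 0.
Proof.
move=> pq xpq; apply: ramp_eq0; rewrite mulr_ge0_le0//.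
move/negP : xpq; rewrite negb_and -!leNgt => /orP[xp|qx]; nra.
Qed.

Lemma cvg_bump p q x : p < x < q -> bump p q n x @[n --> \oo] --> (1 : R).
Proof. by move=> /andP[px xq]; apply: cvg_ramp; rewrite mulr_gt0 ?subr_gt0. Qed.

End ramp.

(** * Derivatives in one variable and along the axes *)

Section one_dimensional.
Variable R : realType.
Implicit Types (F f : R -> R) (p q x : R).

Lemma is_derive_continuous F f : (forall x, is_derive x 1 F (f x)) -> continuous F.
Proof.
move=> D x; apply: differentiable_continuous; apply/derivable1_diffP.
exact: (@ex_derive _ _ _ _ _ _ _ (D x)).
Qed.

Lemma is_derive_little_o F x d e : is_derive x 1 F d -> 0 < e ->
  exists2 r, 0 < r &
    forall y, `|y - x| < r -> `|F y - F x - d * (y - x)| <= e * `|y - x|.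
Proof.
move=> D e0; have [dF FE] := D.
have : h^-1 *: (F (h *: 1 + x) - F x) @[h --> 0^'] --> d by rewrite -FE; exact: dF.
move/cvgrPdist_le => /(_ _ e0) /nbhs_ballP[r /= r0 rB]; exists r => // y yx.
have [->|yx0] := eqVneq y x; first by rewrite !subrr mulr0 subr0 normr0 mulr0.
have h0 : y - x != 0 by rewrite subr_eq0.
have := rB (y - x); rewrite /ball /= sub0r normrN => /(_ yx h0).
rewrite /GRing.scale /= mulr1 subrK => h.
rewrite [X in `|X| <= _](_ : _ = - ((d - (y - x)^-1 * (F y - F x)) * (y - x))).
  by rewrite normrN normrM ler_pM2r// normr_gt0.
by field.
Qed.

Lemma derive_support F f p q x : (forall x, is_derive x 1 F (f x)) ->
  (forall x, ~ (p < x < q) -> F x = 0) -> ~ (p <= x <= q) -> f x = 0.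
Proof.
move=> D F0 xpq; rewrite -(@derive_val _ _ _ _ _ _ _ (D x)).
have -> : 'D_1 F x = 'D_1 (cst 0) x; last by rewrite derive_cst.
apply: near_eq_derive; move/negP : xpq; rewrite negb_and -!ltNge => /orP[xp|qx].
- near=> y; apply: F0; apply/negP; rewrite negb_and -leNgt ltW//.
  by near: y; exact: lt_nbhsl.
- near=> y; apply: F0; apply/negP; rewrite negb_and -!leNgt orbC ltW//.
  by near: y; exact: lt_nbhsr.
Unshelve. all: by end_near. Qed.

Lemma integral_derive_compact_support F f p q : p < q ->
  (forall x, is_derive x 1 F (f x)) -> continuous f ->
  (forall x, ~ (p < x < q) -> F x = 0) ->
  (\int[lebesgue_measure]_x (f x)%:E = 0)%E.
Proof.
move=> pq D cf F0.
have pq1 : p - 1 < q + 1 by lra.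
have cF := is_derive_continuous D.
transitivity (\int[lebesgue_measure]_(x in `[(p - 1)%R, (q + 1)%R]) (f x)%:E)%E.
  rewrite [RHS]integral_mkcond; apply: eq_integral => x _.
  rewrite /patch; case: ifPn => // xI; rewrite (derive_support D F0)//.
  move=> /andP[px xq]; move/negP : xI; apply; rewrite inE /= in_itv /=.
  by apply/andP; split; lra.
rewrite (@continuous_FTC2 _ f F)//.
- by rewrite !F0 ?subee//; apply/negP; rewrite negb_and -!leNgt; apply/orP; [left|right]; lra.
- exact: continuous_subspaceT.
- split.
  + by move=> x _; exact: (@ex_derive _ _ _ _ _ _ _ (D x)).
  + by apply: cvg_at_right_filter; exact: cF.
  + by apply: cvg_at_left_filter; exact: cF.
- by move=> x _; rewrite derive1E; exact: (@derive_val _ _ _ _ _ _ _ (D x)).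
Qed.

Lemma is_derive_partial1 (psi : R * R -> R) x y : differentiable psi (x, y) ->
  is_derive x 1 (fun t => psi (t, y)) ('D_(1, 0) psi (x, y)).
Proof.
move=> dpsi; have D := @diff_derivable R _ _ psi (x, y) (1, 0) dpsi.
have E : (fun h : R => h^-1 *: (((fun t => psi (t, y)) \o shift x) (h *: 1) - psi (x, y))) =
    (fun h : R => h^-1 *: ((psi \o shift (x, y)) (h *: (1, 0)) - psi (x, y))).
  apply/funext => h /=; congr (_ *: (psi _ - _)).
  rewrite -[RHS]/(h *: (1 : R) + x, h *: (0 : R) + y).
  by rewrite scaler0 add0r.
by apply: DeriveDef; [rewrite /derivable E|rewrite /derive E].
Qed.

Lemma is_derive_partial2 (psi : R * R -> R) x y : differentiable psi (x, y) ->
  is_derive y 1 (fun t => psi (x, t)) ('D_(0, 1) psi (x, y)).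
Proof.
move=> dpsi; have D := @diff_derivable R _ _ psi (x, y) (0, 1) dpsi.
have E : (fun h : R => h^-1 *: (((fun t => psi (x, t)) \o shift y) (h *: 1) - psi (x, y))) =
    (fun h : R => h^-1 *: ((psi \o shift (x, y)) (h *: (0, 1)) - psi (x, y))).
  apply/funext => h /=; congr (_ *: (psi _ - _)).
  rewrite -[RHS]/(h *: (0 : R) + x, h *: (1 : R) + y).
  by rewrite scaler0 add0r.
by apply: DeriveDef; [rewrite /derivable E|rewrite /derive E].
Qed.

Lemma continuous_partial1 (F : R * R -> R) y : continuous F -> continuous (fun x => F (x, y)).
Proof.
move=> cF x; apply: (@continuous_comp _ _ _ (fun x => (x, y)) F); last exact: cF.
by apply: (@cvg_pair _ _ _ _ (nbhs x) (nbhs y)); [exact: cvg_id|exact: cvg_cst].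
Qed.

Lemma continuous_partial2 (F : R * R -> R) x : continuous F -> continuous (fun y => F (x, y)).
Proof.
move=> cF y; apply: (@continuous_comp _ _ _ (fun y => (x, y)) F); last exact: cF.
by apply: (@cvg_pair _ _ _ _ (nbhs x) (nbhs y)); [exact: cvg_cst|exact: cvg_id].
Qed.

End one_dimensional.

Section mean_limits_little_o.
Variable R : realType.
Local Notation plane := (R * R)%type.
Local Notation mplane := (measurableTypeR R * measurableTypeR R)%type.
Local Notation mu := (@lebesgue_measure R \x @lebesgue_measure R)%E.
Variable Omega : set plane.
Hypothesis Omega_open : open Omega.

Let mOmega : measurable (Omega : set mplane).
Proof. exact: open_measurable_plane. Qed.

Lemma eball_sub_box (x y : plane) rho : eball x rho y ->
  `|y.1 - x.1| < rho /\ `|y.2 - x.2| < rho.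
Proof.
rewrite /eball /= /enorm /dot /= => h.
have le1 (a b : R) : `|a| <= Num.sqrt (a * a + b * b).
  by rewrite -sqrtr_sqr ler_wsqrtr// expr2 lerDl -expr2 sqr_ge0.
split; apply: le_lt_trans h; first exact: le1.
by rewrite [X in Num.sqrt X]addrC; exact: le1.
Qed.

Lemma mu_eball_le (x : plane) rho : 0 < rho ->
  (mu (eball x rho) <= (4 * rho ^+ 2)%:E)%E.
Proof.
move=> rho0.
pose B : set mplane := `]x.1 - rho, x.1 + rho[%classic `*` `]x.2 - rho, x.2 + rho[%classic.
have mB : measurable B by apply: measurableX; exact: measurable_itv.
apply: (@le_trans _ _ (mu B)).
  apply: le_measure; rewrite ?inE//; first exact: measurable_eball.
  by move=> y /eball_sub_box[y1 y2]; split; rewrite /= in_itv /= -ltr_distlC distrC.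
have -> : mu B = ((2 * rho)%:E * (2 * rho)%:E)%E.
  have I a : lebesgue_measure (`]a - rho, a + rho[%classic : set R) = (2 * rho)%:E.
    rewrite lebesgue_measure_itv /= lte_fin ifT; last by lra.
    by rewrite -EFinB; congr EFin; lra.
  rewrite -[X in (X * _)%E](I x.1) -[X in (_ * X)%E](I x.2).
  by apply: product_measure1E; exact: measurable_itv.
by rewrite -EFinM lee_fin expr2; lra.
Qed.

(** A ball of radius [rho] lies in a square of area [4 * rho ^+ 2], so a uniform bound
    [e * rho ^+ m] on the ball bounds the normalised integral by [4 * e]. *)
Lemma mean_lim0_little_o m (w : mplane -> R) (x : plane) : measurable_fun Omega w ->
  (forall e, 0 < e -> \forall rho \near 0^'+,
     forall y, eball x rho y -> `|w y| <= e * rho ^+ m) ->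
  mean_lim0 Omega m.+2 w x.
Proof.
move=> mw we.
have mOB rho : measurable ((Omega `&` eball x rho) : set mplane).
  by apply: measurableI => //; exact: measurable_eball.
have bound e : 0 < e -> \forall rho \near 0^'+,
    ((rho ^- m.+2)%:E * \int[mu]_(y in Omega `&` eball x rho) `|w y|%:E <= (4 * e)%:E)%E.
  move=> e0; near=> rho.
  have rho0 : 0 < rho by near: rho; exact: nbhs_right_gt.
  have wr : forall y, eball x rho y -> `|w y| <= e * rho ^+ m by near: rho; exact: we.
  apply: (@le_trans _ _ ((rho ^- m.+2)%:E * ((e * rho ^+ m)%:E * (4 * rho ^+ 2)%:E))%E).
    apply: lee_wpmul2l; first by rewrite lee_fin invr_ge0 exprn_ge0// ltW.
    apply: (@le_trans _ _ (\int[mu]_(y in Omega `&` eball x rho) (e * rho ^+ m)%:E)%E).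
      apply: ge0_le_integral => //.
      - apply/measurable_EFinP/measurableT_comp => //.
        by apply: measurable_funS mw => //; exact: subIsetl.
      - by move=> y [_ xy]; rewrite lee_fin wr.
    have -> : (\int[mu]_(y in Omega `&` eball x rho) (e * rho ^+ m)%:E =
       (e * rho ^+ m)%:E * mu (Omega `&` eball x rho))%E by exact: integral_cst.
    apply: lee_wpmul2l; first by rewrite lee_fin mulr_ge0 ?exprn_ge0// ltW.
    apply: le_trans (mu_eball_le x rho0).
    apply: le_measure; rewrite ?inE//; first exact: measurable_eball.
  rewrite -!EFinM lee_fin !exprS expr0 mulr1.
  rewrite [leLHS](_ : _ = 4 * e)//; field.
  by rewrite expf_neq0 ?gt_eqF.
have F0 rho : 0 < rho ->
    (0 <= (rho ^- m.+2)%:E * \int[mu]_(y in Omega `&` eball x rho) `|w y|%:E)%E.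
  move=> rho0; rewrite mule_ge0//; first by rewrite lee_fin invr_ge0 exprn_ge0// ltW.
  by apply: integral_ge0 => y _; rewrite lee_fin.
apply/fine_cvgP; split.
  near=> rho; rewrite ge0_fin_numE; last by apply: F0; near: rho; exact: nbhs_right_gt.
  apply: (@le_lt_trans _ _ (4 * 1)%:E); last by rewrite ltry.
  by near: rho; exact: bound.
apply/cvgrPdist_le => e e0; near=> rho.
have Fe : ((rho ^- m.+2)%:E * \int[mu]_(y in Omega `&` eball x rho) `|w y|%:E <=
    (4 * (e / 4))%:E)%E by near: rho; apply: bound; rewrite divr_gt0.
have Fp := F0 rho; move: Fp Fe => /=.
set F := (_ * _)%E => /(_ _)/= Fp Fe.
have {}Fp : (0 <= F)%E by apply: Fp; near: rho; exact: nbhs_right_gt.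
rewrite sub0r normrN ger0_norm ?fine_ge0// -lee_fin fineK.
  by rewrite (le_trans Fe)// lee_fin; lra.
by rewrite ge0_fin_numE// (le_lt_trans Fe)// ltry.
Unshelve. all: by end_near. Qed.

End mean_limits_little_o.

Section plane_measure.
Variable R : realType.
Local Notation mplane := (measurableTypeR R * measurableTypeR R)%type.
Local Notation mu := (@lebesgue_measure R \x @lebesgue_measure R)%E.

Lemma plane_sigma_finite : sigma_finite (setT : set mplane) mu.
Proof.
have /sigma_finiteP[F [TF ndF Foo]] := sigma_finiteT (@lebesgue_measure R).
exists (fun n => F n `*` F n).
  rewrite -setXTT TF predeqE => -[x y]; split.
    move=> [/= [n _ Fnx] [k _ Fky]]; exists (maxn n k) => //; split.
    - by move: x Fnx; exact/subsetPset/ndF/leq_maxl.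
    - by move: y Fky; exact/subsetPset/ndF/leq_maxr.
  by move=> [n _ []/= ? ?]; split; exists n.
move=> k; have [mF Fk] := Foo k; split; first exact: measurableX.
by rewrite product_measure1E// lte_mul_pinfty// ge0_fin_numE.
Qed.

(* The library instance making products of sigma-finite measures sigma-finite
   is shadowed by the one for finite measures, hence this alias. *)
Definition plane_measure : set mplane -> \bar R := mu.
HB.instance Definition _ := Measure.on plane_measure.
HB.instance Definition _ := Measure_isSigmaFinite.Build _ mplane R plane_measure plane_sigma_finite.

End plane_measure.

(** * Products of compactly supported C^1 functions as admissible directions *)

Section product_bump.
Variable R : realType.
Local Notation plane := (R * R)%type.
Local Notation mplane := (measurableTypeR R * measurableTypeR R)%type.
Local Notation mu := (@lebesgue_measure R \x @lebesgue_measure R)%E.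
Variable Omega : set plane.
Hypothesis Omega_open : open Omega.
Variables (a da b db : R -> R) (p1 q1 p2 q2 : R).
Hypothesis pq1 : p1 < q1.
Hypothesis pq2 : p2 < q2.
Hypothesis a_da : forall x : R, is_derive x 1 a (da x).
Hypothesis b_db : forall x : R, is_derive x 1 b (db x).
Hypothesis cda : continuous da.
Hypothesis cdb : continuous db.
Hypothesis a0 : forall x, ~ (p1 < x < q1) -> a x = 0.
Hypothesis b0 : forall x, ~ (p2 < x < q2) -> b x = 0.

Definition box : set plane := `[p1, q1]%classic `*` `[p2, q2]%classic.

Hypothesis box_sub : box `<=` Omega.

Let ca : continuous a := is_derive_continuous a_da.
Let cb : continuous b := is_derive_continuous b_db.

Let mOmega : measurable (Omega : set mplane).
Proof. exact: open_measurable_plane. Qed.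

Let mbox : measurable (box : set mplane).
Proof. by apply: measurableX; exact: measurable_itv. Qed.

Let compact_box : compact box.
Proof. by apply: compact_setX; exact: segment_compact. Qed.

Let mu_box : (mu box < +oo)%E.
Proof.
rewrite /box product_measure1E//; [|exact: measurable_itv..].
have I p q : p < q -> lebesgue_measure (`[p, q]%classic : set R) = (q - p)%:E.
  by move=> pq; rewrite lebesgue_measure_itv /= lte_fin pq -EFinB.
by rewrite [X in (X * _)%E]I// [X in (_ * X)%E]I// -EFinM ltry.
Qed.

Lemma box_supported_integrable (g : plane -> R) : continuous g ->
  (forall x, ~ box x -> g x = 0) -> mu.-integrable setT (EFin \o g).
Proof.
move=> cg g0.
have -> : EFin \o g = (EFin \o g) \_ box.
  apply/funext => x; rewrite /patch; case: ifPn => //; rewrite notin_setE => /g0 /=.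
  by move=> ->.
rewrite -integrable_mkcond//; apply: measurable_bounded_integrable; [exact: mbox|exact: mu_box|..].
  by apply: measurable_funTS; exact: continuous_measurable_plane.
have [M gM] := compact_support_bounded compact_box cg g0.
by exists M; split; rewrite ?num_real// => c Mc y _; rewrite /= (le_trans (gM y))// ltW.
Qed.

Lemma restrict_box_supported (g : plane -> R) :
  (forall x, ~ box x -> g x = 0) -> g \_ Omega = g.
Proof.
move=> g0; apply/funext => x; rewrite /patch; case: ifPn => //.
by rewrite notin_setE => Ox; rewrite g0// => /box_sub.
Qed.

Lemma box_supported_inL1 (g : plane -> R) : continuous g ->
  (forall x, ~ box x -> g x = 0) -> inL1 Omega g.
Proof.
move=> cg g0; rewrite /inL1 restrict_box_supported//.
exact/Lfun1_integrable/box_supported_integrable.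
Qed.

Lemma box_supported_inL2 (g : plane -> R) : continuous g ->
  (forall x, ~ box x -> g x = 0) -> inL2 Omega g.
Proof.
move=> cg g0; rewrite /inL2 restrict_box_supported//.
apply: Lfun2P; first exact: continuous_measurable_plane.
have : mu.-integrable setT (EFin \o (fun x => g x * g x)).
  apply: box_supported_integrable => [|x nx]; last by rewrite g0// mulr0.
  by move=> x; apply: cvgM; exact: cg.
move/integrableP => [_]; apply: le_lt_trans.
apply: ge0_le_integral => //.
- by move=> x _; rewrite lee_fin -expr2 sqr_ge0.
- apply/measurable_EFinP; apply: measurable_funM; exact: continuous_measurable_plane.
- apply: measurableT_comp => //; apply/measurable_EFinP; apply: measurable_funM;
    exact: continuous_measurable_plane.
- by move=> x _; rewrite /= lee_fin ler_norm.
Qed.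

Definition pbump (x : plane) : R := a x.1 * b x.2.
Definition pbump1 (x : plane) : R := da x.1 * b x.2.
Definition pbump2 (x : plane) : R := a x.1 * db x.2.

Let cfst (f : R -> R) (x : plane) : continuous f -> f y.1 @[y --> x] --> f x.1.
Proof. by move=> cf; apply: (cvg_comp fst f cvg_fst); exact: cf. Qed.

Let csnd (f : R -> R) (x : plane) : continuous f -> f y.2 @[y --> x] --> f x.2.
Proof. by move=> cf; apply: (cvg_comp snd f cvg_snd); exact: cf. Qed.

Lemma continuous_pbump : continuous pbump.
Proof. by move=> x; apply: cvgM; [exact: cfst|exact: csnd]. Qed.

Lemma continuous_pbump1 : continuous pbump1.
Proof. by move=> x; apply: cvgM; [exact: cfst|exact: csnd]. Qed.

Lemma continuous_pbump2 : continuous pbump2.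
Proof. by move=> x; apply: cvgM; [exact: cfst|exact: csnd]. Qed.

Let nbox x : ~ box x -> ~ (p1 <= x.1 <= q1) \/ ~ (p2 <= x.2 <= q2).
Proof. by move=> nx; apply/not_andP => -[x1 x2]; apply: nx; split; rewrite /= in_itv. Qed.

Let weaken (p x q : R) : ~ (p <= x <= q) -> ~ (p < x < q).
Proof. by move=> h /andP[/ltW px /ltW xq]; apply: h; rewrite px xq. Qed.

Lemma pbump0 x : ~ box x -> pbump x = 0.
Proof.
by rewrite /pbump => /nbox[/weaken/a0->|/weaken/b0->]; rewrite ?mul0r ?mulr0.
Qed.

Lemma pbump10 x : ~ box x -> pbump1 x = 0.
Proof.
rewrite /pbump1 => /nbox[x1|/weaken/b0->]; last by rewrite mulr0.
by rewrite (derive_support a_da a0 x1) mul0r.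
Qed.

Lemma pbump20 x : ~ box x -> pbump2 x = 0.
Proof.
rewrite /pbump2 => /nbox[/weaken/a0->|x2]; first by rewrite mul0r.
by rewrite (derive_support b_db b0 x2) mulr0.
Qed.

Let mfg (f g : plane -> R) : continuous f -> continuous g -> continuous (fun x => f x * g x).
Proof. by move=> cf cg x; apply: cvgM; [exact: cf|exact: cg]. Qed.

Let C1_continuous (psi : plane -> R) : C1 psi -> continuous psi.
Proof. by move=> [dpsi _] x; exact: differentiable_continuous. Qed.

(** Reduces integration by parts to the vanishing of the integral of the full derivative of [g psi],
    which the two partial derivatives provide through Fubini. *)
Lemma pbump_by_parts (g dg dpsi psi : plane -> R) :
  continuous g -> continuous dg -> continuous psi -> continuous dpsi ->
  (forall x, ~ box x -> g x = 0) -> (forall x, ~ box x -> dg x = 0) ->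
  (\int[mu]_x (g x * dpsi x + dg x * psi x)%:E = 0)%E ->
  \int[mu]_(x in Omega) (g x * dpsi x) = - \int[mu]_x (dg x * psi x).
Proof.
move=> cg cdg cpsi cdpsi g0 dg0.
have I1 : mu.-integrable setT (EFin \o (fun x => g x * dpsi x)).
  by apply: box_supported_integrable => [|x /g0->]; [exact: mfg|rewrite mul0r].
have I2 : mu.-integrable setT (EFin \o (fun x => dg x * psi x)).
  by apply: box_supported_integrable => [|x /dg0->]; [exact: mfg|rewrite mul0r].
have -> : \int[mu]_(x in Omega) (g x * dpsi x) = \int[mu]_x (g x * dpsi x).
  rewrite Rintegral_mkcond -[in RHS](@restrict_box_supported (fun x => g x * dpsi x))//.
  by move=> x /g0->; rewrite mul0r.
move=> S0; apply/eqP; rewrite -addr_eq0 -RintegralD//; apply/eqP.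
by rewrite /Rintegral S0.
Qed.

Lemma pbump_by_parts1 psi : test_function Omega psi ->
  \int[mu]_(x in Omega) (pbump x * 'D_(1, 0) psi x) = - \int[mu]_x (pbump1 x * psi x).
Proof.
move=> [C1psi _]; have cpsi := C1_continuous C1psi; have [dpsi cdpsi] := C1psi.
apply: pbump_by_parts => //;
  [exact: continuous_pbump|exact: continuous_pbump1|exact: pbump0|exact: pbump10|].
pose F x := pbump x * 'D_(1, 0) psi x + pbump1 x * psi x.
have cF : continuous F.
  move=> x; apply: cvgD; apply: mfg => //.
  - exact: continuous_pbump.
  - exact: continuous_pbump1.
have IF : mu.-integrable setT (EFin \o F).
  apply: box_supported_integrable => // x nx.
  by rewrite /F pbump0// pbump10// !mul0r addr0.
(* The first variable is integrated innermost: each slice is the derivative of a function vanishing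
   outside the open interval from [p1] to [q1]. *)
rewrite -(integral21_prod_meas1 IF) /fubini_G.
rewrite integral0_eq// => y _.
apply: (@integral_derive_compact_support _ (fun x => pbump (x, y) * psi (x, y))
  (fun x => F (x, y)) p1 q1) => //.
- move=> x; have D1 := is_derive_partial1 (dpsi (x, y)).
  have D2 := is_deriveM (is_deriveM (a_da x) (is_derive_cst (b y) x 1)) D1.
  apply: (is_derive_eq D2).
  change (a x * b y * 'D_(1, 0) psi (x, y) + psi (x, y) * (a x * 0 + b y * da x) = F (x, y)).
  rewrite /F /pbump /pbump1 /=; ring.
- exact: continuous_partial1.
- by move=> x nx; rewrite /pbump a0// !mul0r.
Qed.

Lemma pbump_by_parts2 psi : test_function Omega psi ->
  \int[mu]_(x in Omega) (pbump x * 'D_(0, 1) psi x) = - \int[mu]_x (pbump2 x * psi x).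
Proof.
move=> [C1psi _]; have cpsi := C1_continuous C1psi; have [dpsi cdpsi] := C1psi.
apply: pbump_by_parts => //;
  [exact: continuous_pbump|exact: continuous_pbump2|exact: pbump0|exact: pbump20|].
pose F x := pbump x * 'D_(0, 1) psi x + pbump2 x * psi x.
have cF : continuous F.
  move=> x; apply: cvgD; apply: mfg => //.
  - exact: continuous_pbump.
  - exact: continuous_pbump2.
have IF : mu.-integrable setT (EFin \o F).
  apply: box_supported_integrable => // x nx.
  by rewrite /F pbump0// pbump20// !mul0r addr0.
rewrite -(integral12_prod_meas1 IF) /fubini_F.
rewrite integral0_eq// => x _.
apply: (@integral_derive_compact_support _ (fun y => pbump (x, y) * psi (x, y))
  (fun y => F (x, y)) p2 q2) => //.
- move=> y; have D1 := is_derive_partial2 (dpsi (x, y)).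
  have D2 := is_deriveM (is_deriveM (is_derive_cst (a x) y 1) (b_db y)) D1.
  apply: (is_derive_eq D2).
  change (a x * b y * 'D_(0, 1) psi (x, y) + psi (x, y) * (a x * db y + b y * 0) = F (x, y)).
  rewrite /F /pbump /pbump2 /=; ring.
- exact: continuous_partial2.
- by move=> y ny; rewrite /pbump b0// mulr0 mul0r.
Qed.

(** The whole derivative is the charge with density [dg], which is absolutely continuous; the
    singular part is the zero charge. *)
Lemma density_no_cantor (g dg : plane -> R) e :
  continuous dg -> (forall x, ~ box x -> dg x = 0) ->
  (forall psi, test_function Omega psi ->
    \int[mu]_(x in Omega) (g x * 'D_e psi x) = - \int[mu]_x (dg x * psi x)) ->
  no_cantor_derivative Omega g e.
Proof.
move=> cdg dg0 gdg.
have I : (@plane_measure R).-integrable setT (EFin \o dg) by exact: box_supported_integrable.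
exists (induced_charge I), (@czero _ mplane R); split => //.
- move=> psi tpsi; have [mpsi _ bpsi _] := test_function_derive e tpsi.
  rewrite gdg// charge_integralD// (charge_integral_density I)//.
  rewrite (@charge_integralE _ (@czero _ mplane R) psi mzero mzero) ?subrr ?addr0//.
  - exact: ltry.
  - exact: ltry.
  - by move=> A mA; rewrite /czero /mzero /= sube0.
- apply/null_content_dominatesP => A mA A0.
  apply: null_set_integral => //.
  by apply: measurable_funTS; exact: measurable_int I.
- by exists set0; split => //; rewrite measure0.
Qed.

Let mpbump : measurable_fun (setT : set mplane) pbump.
Proof. exact: (continuous_measurable_plane continuous_pbump). Qed.

Lemma SBV_pbump : SBV Omega pbump.
Proof.
split.
- by apply: box_supported_inL1; [exact: continuous_pbump|exact: pbump0].
- apply: (density_no_cantor continuous_pbump1 pbump10); exact: pbump_by_parts1.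
- apply: (density_no_cantor continuous_pbump2 pbump20); exact: pbump_by_parts2.
Qed.

Lemma approx_lim_pbump x : approx_lim Omega pbump x (pbump x).
Proof.
apply: (@mean_lim0_little_o _ _ Omega_open 0 (fun y => pbump y - pbump x)).
  exact: measurable_funTS (measurable_funB mpbump (measurable_cst _)).
move=> e e0; have /cvgrPdist_le/(_ _ e0) := @continuous_pbump x.
move=> /nbhs_ballP[d /= d0 dx]; near=> rho => y /eball_sub_box[y1 y2].
rewrite expr0 mulr1 distrC; apply: dx; split => /=; rewrite /ball /= distrC.
- by rewrite (lt_le_trans y1)//; near: rho; exact: nbhs_right_le.
- by rewrite (lt_le_trans y2)//; near: rho; exact: nbhs_right_le.
Unshelve. all: by end_near. Qed.

Lemma is_approx_grad_pbump x : is_approx_grad Omega pbump x (pbump1 x, pbump2 x).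
Proof.
exists (pbump x); first exact: approx_lim_pbump.
pose G : plane := (pbump1 x, pbump2 x).
apply: (@mean_lim0_little_o _ _ Omega_open 1 (fun y => pbump y - pbump x - dot G (y - x))).
  have m1 := measurable_funB mpbump (@measurable_cst _ _ mplane _ setT (pbump x)).
  exact: measurable_funTS (measurable_funB m1 (measurable_dot G x)).
have [M M0 bM] : exists2 M, 0 < M & forall y, `|b y| <= M.
  have bz y : ~ `[p2, q2]%classic y -> b y = 0.
    by move=> ny; apply/b0/weaken => py; apply: ny; rewrite /= in_itv.
  have [M bM] := compact_support_bounded (@segment_compact _ p2 q2) cb bz.
  exists (M + 1) => [|y]; last by rewrite (le_trans (bM y))// lerDl.
  by rewrite ltr_wpDl// (le_trans _ (bM 0)).
move=> e e0.
have e3 : 0 < e / 3 by rewrite divr_gt0.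
have da1 : 0 < `|da x.1| + 1 by rewrite ltr_wpDl.
have a1 : 0 < `|a x.1| + 1 by rewrite ltr_wpDl.
have [r1 r10 h1] := is_derive_little_o (a_da x.1) (divr_gt0 e3 M0).
have [r3 r30 h3] := is_derive_little_o (b_db x.2) (divr_gt0 e3 a1).
have /cvgrPdist_le/(_ _ (divr_gt0 e3 da1)) := @cb x.2.
move=> /nbhs_ballP[r2 /= r20 h2].
near=> rho => y /eball_sub_box[y1 y2]; rewrite expr1.
have rho1 : rho <= r1 by near: rho; exact: nbhs_right_le.
have rho2 : rho <= r2 by near: rho; exact: nbhs_right_le.
have rho3 : rho <= r3 by near: rho; exact: nbhs_right_le.
have {}h1 := h1 _ (lt_le_trans y1 rho1).
have {}h3 := h3 _ (lt_le_trans y2 rho3).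
have {}h2 : `|b x.2 - b y.2| <= e / 3 / (`|da x.1| + 1).
  by apply: h2; rewrite /ball /= distrC (lt_le_trans y2).
(* Product rule with remainder: the first-order error of [a], the variation of [b], and the
   first-order error of [b]. The three tolerances above were divided by bounds on the cofactors so
   that each term is at most [e / 3 * rho]. *)
rewrite [X in `|X|](_ : _ =
  (a y.1 - a x.1 - da x.1 * (y.1 - x.1)) * b y.2 +
  da x.1 * (y.1 - x.1) * (b y.2 - b x.2) +
  a x.1 * (b y.2 - b x.2 - db x.2 * (y.2 - x.2))); last first.
  by rewrite /pbump /dot /G /pbump1 /pbump2 /=; ring.
have rho0 : 0 < rho by near: rho; exact: nbhs_right_gt.
have t1 : `|(a y.1 - a x.1 - da x.1 * (y.1 - x.1)) * b y.2| <= e / 3 * rho.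
  rewrite normrM (le_trans (ler_pM _ _ h1 (bM y.2)))// mulrAC divfK ?gt_eqF//.
  by rewrite ler_pM2l// ltW.
have t2 : `|da x.1 * (y.1 - x.1) * (b y.2 - b x.2)| <= e / 3 * rho.
  rewrite !normrM [`|b y.2 - _|]distrC.
  rewrite -mulrA (le_trans (ler_wpM2l (normr_ge0 (da x.1))
    (ler_pM (normr_ge0 _) (normr_ge0 _) (ltW y1) h2)))//.
  rewrite [leLHS](_ : _ = e / 3 * rho * (`|da x.1| / (`|da x.1| + 1))); last by ring.
  apply: ler_piMr; first by rewrite ltW// mulr_gt0.
  by rewrite ler_pdivrMr// mul1r lerDl.
have t3 : `|a x.1 * (b y.2 - b x.2 - db x.2 * (y.2 - x.2))| <= e / 3 * rho.
  rewrite normrM.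
  have := ler_pM (normr_ge0 _) (normr_ge0 _) (lexx `|a x.1|) h3.
  move=> h; apply: (le_trans h).
  rewrite [leLHS](_ : _ = e / 3 * (`|a x.1| / (`|a x.1| + 1) * `|y.2 - x.2|)); last by ring.
  rewrite ler_pM2l//; apply: (@le_trans _ _ (1 * rho)); last by rewrite mul1r.
  by rewrite ler_pM ?divr_ge0// ?(ltW y2)// ler_pdivrMr// mul1r lerDl.
rewrite (le_trans (ler_normD _ _))// (_ : e * rho = (e / 3 * rho + e / 3 * rho) + e / 3 * rho); last by field.
by rewrite lerD// (le_trans (ler_normD _ _))// lerD.
Unshelve. all: by end_near. Qed.

Lemma grad_pair_pbump S : grad_pair Omega S (pbump, (pbump1, pbump2)).
Proof.
split.
- exact: SBV_pbump.
- by apply: box_supported_inL2; [exact: continuous_pbump|exact: pbump0].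
- by apply: box_supported_inL2; [exact: continuous_pbump1|exact: pbump10].
- by apply: box_supported_inL2; [exact: continuous_pbump2|exact: pbump20].
split; first by apply: aeW => x _; exact: is_approx_grad_pbump.
rewrite /h1_subset (_ : _ `\` _ = set0) ?hausdorff1_set0//.
by apply/seteqP; split => // x [[_ nx] _]; apply: nx; exists (pbump x); exact: approx_lim_pbump.
Qed.

(** A continuous function is its own approximate limit, and a boundary point of the open set [Omega]
    lies outside the closed box that supports the bump. *)
Lemma zero_trace_pbump : zero_trace Omega pbump.
Proof.
rewrite /zero_trace /h1_ae_boundary (_ : _ `&` _ = set0) ?hausdorff1_set0//.
apply/seteqP; split => // x [[_ nx]] /=; apply.
have <- : pbump x = 0; last exact: approx_lim_pbump.
apply: pbump0 => /box_sub Ox; apply: nx.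
by have /interior_id -> := Omega_open.
Qed.

End product_bump.

(** * Functions orthogonal to product bumps *)

Section open_boxes.
Variable R : realType.
Local Notation plane := (R * R)%type.
Local Notation mplane := (measurableTypeR R * measurableTypeR R)%type.
Local Notation mu := (@lebesgue_measure R \x @lebesgue_measure R)%E.

Definition open_box (p1 q1 p2 q2 : R) : set mplane := `]p1, q1[%classic `*` `]p2, q2[%classic.

Definition open_boxes : set (set mplane) :=
  [set A | exists p1 q1 p2 q2, A = open_box p1 q1 p2 q2].

Lemma measurable_open_box p1 q1 p2 q2 : measurable (open_box p1 q1 p2 q2).
Proof. by apply: measurableX; exact: measurable_itv. Qed.

Lemma mu_open_box p1 q1 p2 q2 : (mu (open_box p1 q1 p2 q2) < +oo)%E.
Proof.
apply: (@le_lt_trans _ _ (mu (open_box p1 (Num.max p1 q1) p2 (Num.max p2 q2)))).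
  apply: le_measure; rewrite ?inE//; try exact: measurable_open_box.
  move=> x; rewrite /open_box /= !in_itv /= => -[/andP[-> x1] /andP[-> x2]].
  by rewrite !lt_max x1 x2 !orbT.
have I (p q : R) : p <= q -> lebesgue_measure (`]p, q[%classic : set R) = (q - p)%:E.
  rewrite le_eqVlt lebesgue_measure_itv /= lte_fin => /orP[/eqP->|pq].
    by rewrite ltxx subrr.
  by rewrite pq -EFinB.
rewrite /open_box product_measure1E//; [|exact: measurable_itv..].
by rewrite [X in (X * _)%E]I ?le_max ?lexx// [X in (_ * X)%E]I ?le_max ?lexx// -EFinM ltry.
Qed.

Lemma open_boxI p1 q1 p2 q2 r1 s1 r2 s2 :
  open_box p1 q1 p2 q2 `&` open_box r1 s1 r2 s2 =
  open_box (Num.max p1 r1) (Num.min q1 s1) (Num.max p2 r2) (Num.min q2 s2).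
Proof.
apply/seteqP; split => x; rewrite /open_box /= !in_itv /= !gt_max !lt_min.
  by move=> [[/andP[-> ->] /andP[-> ->]] [/andP[-> ->] /andP[-> ->]]].
by move=> [/andP[/andP[-> ->] /andP[-> ->]] /andP[/andP[-> ->] /andP[-> ->]]].
Qed.

Lemma bigcup_open_itv : \bigcup_n `](- n%:R), n%:R[%classic = [set: R].
Proof.
apply/seteqP; split => // x _; exists (Num.truncn `|x|).+1 => //=.
by rewrite in_itv /= -ltr_norml truncnS_gt.
Qed.

(** Strips are countable unions of open boxes, so both projections are measurable for the
    sigma-algebra generated by the boxes, and hence so is the identity into the product. *)
Lemma measurable_open_boxes (X : set mplane) : measurable X -> <<s open_boxes >> X.
Proof.
move=> mX.
pose GT := g_sigma_algebraType open_boxes.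
have mb p1 q1 p2 q2 : measurable (open_box p1 q1 p2 q2 : set GT).
  by apply: sub_sigma_algebra; exists p1, q1, p2, q2.
have m1 : measurable_fun (setT : set GT) (fst : GT -> measurableTypeR R).
  apply: (measurability _ (RGenOpens.measurableE R)).
  move=> _ [_ [x [y ->] <-]]; rewrite setTI.
  rewrite (_ : _ @^-1` _ = \bigcup_n open_box x y (- n%:R) n%:R); first exact: bigcupT_measurable.
  apply/seteqP; split => [z /= xz|z [n _] []//].
  have [n _ zn] : (\bigcup_n `](- n%:R), n%:R[%classic) z.2 by rewrite bigcup_open_itv.
  by exists n.
have m2 : measurable_fun (setT : set GT) (snd : GT -> measurableTypeR R).
  apply: (measurability _ (RGenOpens.measurableE R)).
  move=> _ [_ [x [y ->] <-]]; rewrite setTI.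
  rewrite (_ : _ @^-1` _ = \bigcup_n open_box (- n%:R) n%:R x y); first exact: bigcupT_measurable.
  apply/seteqP; split => [z /= xz|z [n _] []//].
  have [n _ zn] : (\bigcup_n `](- n%:R), n%:R[%classic) z.1 by rewrite bigcup_open_itv.
  by exists n.
have mid : measurable_fun (setT : set GT) (id : GT -> mplane).
  by apply/measurable_fun_pairP.
by have := mid measurableT X mX; rewrite setTI.
Qed.

(** The finite measures with densities [|k|] and [|k| - k] agree on open boxes, which are stable
    under intersection and generate the sigma-algebra. They therefore agree everywhere, and [k] has
    zero integral over every measurable set. *)
Lemma integral_open_boxes_ae0 (k : mplane -> R) : mu.-integrable setT (EFin \o k) ->
  (forall p1 q1 p2 q2, \int[mu]_(x in open_box p1 q1 p2 q2) (k x)%:E = 0)%E ->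
  {ae mu, forall x, k x = 0}.
Proof.
move=> kint k0.
pose a x := `|k x|; pose b x := `|k x| - k x.
have aint : mu.-integrable setT (EFin \o a) by exact: (integrable_abse kint).
have bint : mu.-integrable setT (EFin \o b) by exact: (integrableB measurableT aint kint).
have a0 x : (0 <= (EFin \o a) x)%E by rewrite lee_fin /a.
have b0 x : (0 <= (EFin \o b) x)%E by rewrite lee_fin subr_ge0 ler_norm.
pose m1 := density_measure aint a0; pose m2 := density_measure bint b0.
have mE A : measurable A -> (m2 A = m1 A - \int[mu]_(x in A) (k x)%:E)%E.
  move=> mA; rewrite /m2 /m1 !density_measureE -integralB//.
  - exact: (integrableS measurableT mA (@subsetT _ A) aint).
  - exact: (integrableS measurableT mA (@subsetT _ A) kint).
have m12 A : measurable A -> m1 A = m2 A.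
  move=> /measurable_open_boxes; apply: (g_sigma_algebra_measure_unique open_boxes _
    (fun n => open_box (- n%:R) n%:R (- n%:R) n%:R)).
  - by move=> _ [p1 [q1 [p2 [q2 ->]]]]; exact: measurable_open_box.
  - by move=> n; exists (- n%:R), n%:R, (- n%:R), n%:R.
  - apply/seteqP; split => // x _; exists (Num.truncn (Num.max `|x.1| `|x.2|)).+1 => //.
    have := truncnS_gt (Num.max `|x.1| `|x.2|); rewrite gt_max => /andP[x1 x2].
    by split; rewrite /= in_itv /= -ltr_norml.
  - move=> _ _ [p1 [q1 [p2 [q2 ->]]]] [r1 [s1 [r2 [s2 ->]]]]; rewrite open_boxI.
    by do 4 eexists.
  - move=> _ [p1 [q1 [p2 [q2 ->]]]].
    rewrite -[LHS]/(m1 _) -[RHS]/(m2 _).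
    by rewrite mE ?k0 ?sube0//; exact: measurable_open_box.
  - move=> n; apply: (@le_lt_trans _ _ (m1 setT)).
      by apply: le_measure; rewrite ?inE//; exact: measurable_open_box.
    by rewrite ltey_eq fin_num_measure.
have : ae_eq mu setT (EFin \o k) (cst 0%E).
  apply: integral_ae_eq => // A _ mA; rewrite integral0.
  have fA : m1 A \is a fin_num by exact: fin_num_measure.
  have := mE A mA; rewrite -m12//.
  have : (\int[mu]_(x in A) (k x)%:E)%E \is a fin_num.
    by apply: integrable_fin_num => //; exact: integrableS kint.
  move=> fk; rewrite /comp -(fineK fA) -(fineK fk) -EFinB => -[] h; congr EFin; lra.
by apply: ae_plane1 => x /(_ I) [].
Qed.

End open_boxes.

Section bumps_are_dense.
Variable R : realType.
Local Notation plane := (R * R)%type.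
Local Notation mplane := (measurableTypeR R * measurableTypeR R)%type.
Local Notation mu := (@lebesgue_measure R \x @lebesgue_measure R)%E.
Variables (Omega : set plane) (h : plane -> R).
Hypothesis Omega_open : open Omega.
Hypothesis hL : inL2 Omega h.

Let mOmega : measurable (Omega : set mplane).
Proof. exact: open_measurable_plane. Qed.

Hypothesis h_orth : forall p1 q1 p2 q2 n, p1 < q1 -> p2 < q2 -> box p1 q1 p2 q2 `<=` Omega ->
  ipO Omega h (pbump (bump p1 q1 n) (bump p2 q2 n)) = 0.

Let open_box_sub p1 q1 p2 q2 : (open_box p1 q1 p2 q2 : set plane) `<=` box p1 q1 p2 q2.
Proof.
by move=> x; rewrite /open_box /box /= !in_itv /= => -[/andP[/ltW-> /ltW->] /andP[/ltW-> /ltW->]].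
Qed.

Lemma integrable_open_box p1 q1 p2 q2 : box p1 q1 p2 q2 `<=` Omega ->
  mu.-integrable (open_box p1 q1 p2 q2) (EFin \o h).
Proof.
move=> bO; have mB := measurable_open_box p1 q1 p2 q2.
have oneL : inL2 Omega (\1_(open_box p1 q1 p2 q2)).
  apply: (restrict_Lfun2 Omega_open _).1; apply: Lfun2P; first exact: measurable_indic.
  apply: (@le_lt_trans _ _ (\int[mu]_x (\1_(open_box p1 q1 p2 q2) x)%:E)%E).
    apply: ge0_le_integral => //.
    - by apply/measurable_EFinP; apply: measurable_funM; exact: measurable_indic.
    - by apply/measurable_EFinP; exact: measurable_indic.
    - by move=> x _; rewrite lee_fin indicE -natrM ler_nat; case: (x \in _).
  by rewrite integral_indic// setIT mu_open_box.
have := ipO_integrable Omega_open hL oneL.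
have BO := subset_trans (@open_box_sub p1 q1 p2 q2) bO.
move=> /(integrableS mOmega mB BO).
apply: eq_integrable => // x xB.
by rewrite indicE xB mulr1.
Qed.

(** Dominated convergence: the bumps take values between 0 and 1 and tend to 1 on the open box,
    while each of their products with [h] has integral zero. *)
Lemma integral_open_box_eq0 p1 q1 p2 q2 : box p1 q1 p2 q2 `<=` Omega ->
  (\int[mu]_(x in open_box p1 q1 p2 q2) (h x)%:E = 0)%E.
Proof.
have [/andP[pq1 pq2] bO|ne _] := boolP ((p1 < q1) && (p2 < q2)); last first.
  rewrite (_ : open_box _ _ _ _ = set0) ?integral_set0//.
  apply/seteqP; split => // x; rewrite /open_box /= !in_itv /= => -[/andP[a b] /andP[c d]].
  by move: ne; rewrite (lt_trans a b) (lt_trans c d).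
have mB := measurable_open_box p1 q1 p2 q2.
have Ih := integrable_open_box bO.
have BO := subset_trans (@open_box_sub p1 q1 p2 q2) bO.
pose F n (x : mplane) := (h x * pbump (bump p1 q1 n) (bump p2 q2 n) x)%:E.
have mh : measurable_fun (open_box p1 q1 p2 q2) h.
  by apply/(@measurable_EFinP _ mplane); exact: measurable_int Ih.
have mbump n : measurable_fun (setT : set mplane) (pbump (bump p1 q1 n) (bump p2 q2 n)).
  apply: continuous_measurable_plane; apply: continuous_pbump => x; exact: is_derive_bump.
have F0 n : (\int[mu]_(x in open_box p1 q1 p2 q2) F n x = 0)%E.
  have pL : inL2 Omega (pbump (bump p1 q1 n) (bump p2 q2 n)).
    have [//] := @grad_pair_pbump R Omega Omega_open _ _ _ _ _ _ _ _ pq1 pq2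
      (is_derive_bump p1 q1 n) (is_derive_bump p2 q2 n)
      (@continuous_bump' _ p1 q1 n) (@continuous_bump' _ p2 q2 n)
      (fun x => @bump_eq0 _ p1 q1 n x pq1) (fun x => @bump_eq0 _ p2 q2 n x pq2) bO set0.
  transitivity (\int[mu]_(x in Omega) (h x * pbump (bump p1 q1 n) (bump p2 q2 n) x)%:E)%E; last first.
    by rewrite EFin_ipO// h_orth.
  rewrite integral_mkcond [RHS]integral_mkcond; apply: eq_integral => x _.
  rewrite /patch; case: ifPn => xB; first by rewrite mem_set//; apply: BO; exact: set_mem.
  case: ifPn => // xO; rewrite /pbump; move: xB; rewrite notin_setE => nx.
  have [x1|x1] := pselect (p1 < x.1 < q1); last by rewrite (bump_eq0 _ pq1 x1) mul0r mulr0.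
  have [x2|x2] := pselect (p2 < x.2 < q2); last by rewrite (bump_eq0 _ pq2 x2) !mulr0.
  by exfalso; apply: nx; split; rewrite /= in_itv.
have bump01 (p q : R) n x : 0 <= bump p q n x <= 1 by rewrite ramp_ge0 ramp_le1.
have mF n : measurable_fun (open_box p1 q1 p2 q2) (F n).
  by apply/measurable_EFinP; apply: measurable_funM => //; exact: measurable_funTS.
have Fh : {ae mu, forall x, open_box p1 q1 p2 q2 x -> F n x @[n --> \oo] --> (EFin \o h) x}.
  apply: aeW => x; rewrite /open_box /= !in_itv /= => -[x1 x2].
  apply: cvg_EFin_fun; rewrite -[X in _ --> X]mulr1 -[X in _ * X]mulr1.
  by apply: cvgM; [exact: cvg_cst|apply: cvgM; exact: cvg_bump].
have FM : {ae mu, forall x n, open_box p1 q1 p2 q2 x -> (`|F n x| <= `|(EFin \o h) x|)%E}.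
  apply: aeW => x n _; rewrite lee_fin normrM ler_piMr// /pbump normrM.
  have /andP[a0 a1] := bump01 p1 q1 n x.1; have /andP[b0 b1] := bump01 p2 q2 n x.2.
  by rewrite !ger0_norm// mulr_ile1.
have [_ _] := dominated_convergence mB mF (measurable_int _ Ih) Fh (integrable_abse Ih) FM.
rewrite (_ : (fun _ => _) = cst 0%E); last by apply/funext => n; exact: F0.
by move/cvg_lim => <-//; rewrite lim_cst.
Qed.

Lemma open_box_ae0 p1 q1 p2 q2 : box p1 q1 p2 q2 `<=` Omega ->
  {ae mu, forall x, open_box p1 q1 p2 q2 x -> h x = 0}.
Proof.
move=> bO; have mB := measurable_open_box p1 q1 p2 q2.
have Ih := integrable_open_box bO.
have : {ae mu, forall x, (h \_ (open_box p1 q1 p2 q2)) x = 0}.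
  apply: integral_open_boxes_ae0.
    have := Ih; rewrite integrable_mkcond//; apply: eq_integrable => // x _.
    by rewrite /patch /=; case: ifP.
  move=> r1 s1 r2 s2.
  transitivity (\int[mu]_(x in open_box r1 s1 r2 s2 `&` open_box p1 q1 p2 q2) (h x)%:E)%E.
    rewrite [RHS]integral_mkcondr; apply: eq_integral => x _.
    by rewrite /patch /=; case: ifP.
  (* The cut-off of [h] to the box is tested on arbitrary boxes: the intersection is again an open
     box, and its closed counterpart still lies in [Omega]. *)
  rewrite open_boxI; apply: integral_open_box_eq0 => x bx; apply: bO; move: bx.
  rewrite /box /= !in_itv /= !ge_max !le_min.
  by move=> [/andP[/andP[_ ->] /andP[_ ->]] /andP[/andP[_ ->] /andP[_ ->]]].
by apply: ae_plane1 => x + xB; rewrite patchE mem_set.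
Qed.

Lemma orthogonal_to_bumps_ae0 : {ae mu, forall x, Omega x -> h x = 0}.
Proof.
pose c (i : rat * rat * nat) : set mplane := open_box
  (ratr i.1.1 - i.2.+1%:R^-1) (ratr i.1.1 + i.2.+1%:R^-1)
  (ratr i.1.2 - i.2.+1%:R^-1) (ratr i.1.2 + i.2.+1%:R^-1).
pose b (i : rat * rat * nat) : set plane := box
  (ratr i.1.1 - i.2.+1%:R^-1) (ratr i.1.1 + i.2.+1%:R^-1)
  (ratr i.1.2 - i.2.+1%:R^-1) (ratr i.1.2 + i.2.+1%:R^-1).
(* The exceptional set of the rational box with code [k]; it is empty when [k] codes no box or the
   box is not contained in [Omega]. *)
pose N k : set mplane := [set x | exists i,
  [/\ unpickle k = Some i, b i `<=` Omega, c i x & h x <> 0]].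
have N0 k : mu.-negligible (N k).
  case ik : (unpickle k : option (rat * rat * nat)) => [i|]; last first.
    by rewrite (_ : N k = set0); [exact: negligible_set0|apply/seteqP; split => // x]; move=> [i []]; rewrite ik.
  have [bi|nbi] := pselect (b i `<=` Omega); last first.
    by rewrite (_ : N k = set0); [exact: negligible_set0|apply/seteqP; split => // x]; move=> [j []]; rewrite ik => -[<-].
  apply: negligibleS (open_box_ae0 bi) => x [j []]; rewrite ik => -[<-] _ cx hx /=.
  by move/(_ cx).
apply: negligibleS (negligible_bigcup N0) => x /= /not_implyP[Ox hx].
have [i [x1 x2 iO]] := open_rational_box Omega_open Ox.
exists (pickle i) => //; exists i; split => //; first exact: pickleK.
- move=> y; rewrite /b /box /= !in_itv /= => -[y1 y2].
  by apply: iO; rewrite distrC ler_distl.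
- by split; rewrite /= in_itv /= -ltr_distl distrC.
Qed.

End bumps_are_dense.

Section uniqueness.
Variable R : realType.
Local Notation plane := (R * R)%type.
Local Notation mplane := (measurableTypeR R * measurableTypeR R)%type.
Local Notation mu := (@lebesgue_measure R \x @lebesgue_measure R)%E.
Variables (Omega : set plane).
Hypothesis Omega_open : open Omega.

(** Carries an identity known only for zero-trace directions over to directions with arbitrary
    trace: the zero-trace pairs contain all product bumps, so [f - g] vanishes almost everywhere in
    [Omega]. *)
Lemma zero_trace_grad_pairs_separate S f g : inL2 Omega f -> inL2 Omega g ->
  (forall p, grad_pair Omega S p -> zero_trace Omega p.1 ->
     ipO Omega f p.1 = ipO Omega g p.1) ->
  forall phi, inL2 Omega phi -> ipO Omega f phi = ipO Omega g phi.
Proof.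
move=> fL gL fg phi phiL.
pose h y := 1 * f y + -1 * g y.
have hL : inL2 Omega h by exact: inL2_comb.
have hE psi : inL2 Omega psi -> ipO Omega h psi = ipO Omega f psi - ipO Omega g psi.
  move=> psiL; rewrite /ipO restrict_comb [LHS]ipC ip_combr// mul1r mulN1r.
  by congr (_ - _); exact: ipC.
have h0 : {ae mu, forall x, Omega x -> h x = 0}.
  apply: orthogonal_to_bumps_ae0 => // p1 q1 p2 q2 n pq1 pq2 bO.
  have bP := @grad_pair_pbump R Omega Omega_open _ _ _ _ _ _ _ _ pq1 pq2
    (is_derive_bump p1 q1 n) (is_derive_bump p2 q2 n)
    (@continuous_bump' _ p1 q1 n) (@continuous_bump' _ p2 q2 n)
    (fun x => @bump_eq0 _ p1 q1 n x pq1) (fun x => @bump_eq0 _ p2 q2 n x pq2) bO S.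
  have bZ := @zero_trace_pbump R Omega Omega_open _ _ _ _ _ _ _ _
    (is_derive_bump p1 q1 n) (is_derive_bump p2 q2 n)
    (fun x => @bump_eq0 _ p1 q1 n x pq1) (fun x => @bump_eq0 _ p2 q2 n x pq2) bO.
  have [_ bL _ _ _] := bP.
  by rewrite (hE _ bL) (fg _ bP bZ) subrr.
apply/eqP; rewrite -subr_eq0 -hE//; apply/eqP.
by rewrite /ipO ipC; exact: ipO_ae0.
Qed.

End uniqueness.

Theorem proposition1p1 (R : realType) (Omega S : set (R * R)) (u : R * R -> R)
    (Omega_open : open Omega) (Omega_bounded : bounded_set Omega)
    (Omega_C1 : C1_boundary Omega)
    (S_Omega : S `<=` Omega) (S_finite : (hausdorff1 S < +oo)%E)
    (u_SBV2 : SBV2 Omega S u) (u_slope : (slope_bc Omega u S < +oo)%E) :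
  exists f : R * R -> R,
    [/\ inL2 Omega f,
        forall phi, SBV2_0 Omega S phi ->
          L2dotv Omega (approx_grad Omega u) (approx_grad Omega phi)
          = L2dot Omega f phi,
        (2%:E * L2norm Omega f <= slope_bc Omega u S)%E &
        ((slope Omega u S < +oo)%E ->
          forall phi, SBV2 Omega S phi ->
            L2dotv Omega (approx_grad Omega u) (approx_grad Omega phi)
            = L2dot Omega f phi)].
Proof.
set C := same_trace Omega u; set Z := zero_trace Omega.
have [|phi psi a c phiL psiL|f [fL fE f_le]] := 
  @riesz_slope R Omega Omega_open C Z S u S_finite u_SBV2 u_slope.
- move=> phi c phiL phiZ.
  rewrite (_ : (fun y => _) = (fun y => u y + c * phi y)); last by apply/funext => y; rewrite mul1r.
  apply: (same_trace_comb Omega_open) => //; apply: (inL2_measurable Omega_open) => //.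
  by case: u_SBV2.
- apply: (zero_trace_comb Omega_open); exact: (inL2_measurable Omega_open).
have [_ _ uG1 uG2 _] := SBV2_grad_pair Omega_open u_SBV2.
have gradE phi : SBV2 Omega S phi ->
    L2dotv Omega (approx_grad Omega u) (approx_grad Omega phi) =
    grad_dot Omega (gradient Omega u) (gradient Omega phi).
  move=> phiS; have [_ _ pG1 pG2 _] := SBV2_grad_pair Omega_open phiS.
  exact: (L2dotvE Omega_open uG1 uG2 pG1 pG2).
exists f; split => //.
- move=> phi [phiS phiZ]; rewrite gradE// L2dotE.
  by rewrite -(fE _ (SBV2_grad_pair Omega_open phiS) phiZ).
move=> sl phi phiS.
have [//|//|g [gL gE _]] := 
  @riesz_slope R Omega Omega_open (fun=> True) (fun=> True) S u S_finite u_SBV2 sl.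
have [_ phiL _ _ _] := SBV2_grad_pair Omega_open phiS.
rewrite gradE// L2dotE (zero_trace_grad_pairs_separate Omega_open (S := S) fL gL)//.
  by rewrite -(gE _ (SBV2_grad_pair Omega_open phiS)).
(* On zero-trace pairs [f] and [g] represent the same functional, since [g] represents it on all
   pairs. *)
by move=> p pS pZ; rewrite fE// gE.
Qed.
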